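(* Let $X$ be an infinite-dimensional Banach space over $\mathbb{K}$. Then there are a Banach space $Y$ over $\mathbb{K}$, a linear isometry $J:X\longrightarrow Y$ (i.e. $Y$ is a superspace of $X$) and a bounded linear operator $T:X\longrightarrow Y$ such that $\overline{\mathrm{co}}\,W(T)\neq V(T)$, where $W(T)$ and $V(T)$ are the spatial and the intrinsic numerical ranges of $T|_{S_X}$ (computed with respect to the inclusion $J$).
   Context: $\mathbb{K}$ is $\mathbb{R}$ or $\mathbb{C}$. For a Banach space $Y$, $S_Y$ is its unit sphere and $Y^*$ its dual; for $u\in S_Y$, $D(Y,u)=\{y^*\in Y^* : \|y^*\|=y^*(u)=1\}$. Let $X$ be a closed subspace of $Y$ with inclusion $J:X\to Y$ (a linear isometry; one then says $Y$ is a superspace of $X$). Put $\Pi(X,Y)=\{(x,y^* )\in S_X\times S_{Y^*} : y^*\in D(Y,Jx)\}$. Let $B(S_X,Y)$ be the Banach space of all bounded functions from $S_X$ to $Y$ with the supremum norm. For $f\in B(S_X,Y)$, the spatial numerical range is $W(f)=\{y^*(f(x)) : (x,y^* )\in\Pi(X,Y)\}$ and the intrinsic numerical range is $V(f)=\{\Phi(f) : \Phi\in D(B(S_X,Y),J|_{S_X})\}$. A bounded linear operator $T:X\to Y$ is identified with $T|_{S_X}\in B(S_X,Y)$. $\overline{\mathrm{co}}$ denotes closed convex hull. *)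

(* Defs.v *)
From HB Require Import structures.
From mathcomp Require Import all_boot all_order all_algebra complex.
From mathcomp Require Import all_classical all_reals all_analysis.

Set Implicit Arguments.
Unset Strict Implicit.
Unset Printing Implicit Defensive.

Import Order.TTheory GRing.Theory Num.Theory.
Import numFieldNormedType.Exports.

Local Open Scope classical_set_scope.
Local Open Scope ring_scope.

Variant scalar_kind := RealScalars | ComplexScalars.

Definition scalars (R : realType) (k : scalar_kind) : numFieldType :=
  match k with
  | RealScalars => R
  | ComplexScalars => R[i]
  end.

(* Norms of [normedModType K] take their values in [K] itself; for [K = R[i]]
   they are real elements of [K], and [supremum] refers to the partial order
   of [K], which restricts to the usual order on real elements.  This lemma
   says that these suprema exist. *)
Lemma scalars_supremum (R : realType) (k : scalar_kind)
    (A : set (scalars R k)) :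
  A !=set0 -> (forall a, A a -> 0 <= a) -> has_ubound A ->
  supremums A (supremum 0 A).
Proof.
move=> A0 Age0 Aub.
suff [s sA] : exists s, supremums A s.
  rewrite /supremum; case: ifPn => [/eqP AE|_].
    by move: A0; rewrite AE => -[].
  by case: xgetP => [y -> //|/(_ s)].
case: k A A0 Age0 Aub => A A0 Age0 [M ubM].
  exists (sup (A : set R)).
  have supA : has_sup (A : set R) by split => //; exists M.
  split; first exact: (sup_upper_bound supA).
  by move=> b ubb; apply: ge_sup.
pose B : set R := [set r | A (r%:C)%C].
have AE (a : R[i]) : A a -> a = ((complex.Re a)%:C)%C.
  move=> /Age0; case: a => x y; rewrite lecE /= => /andP[/eqP -> _].
  by [].
have Bsup : has_sup B.
  split.
    by case: A0 => a Aa; exists (complex.Re a); rewrite /B/= -(AE _ Aa).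
  exists (complex.Re M) => r Br; have := ubM _ Br.
  by case: (M) => x y; rewrite lecE /= => /andP[_].
exists ((sup B)%:C)%C; split.
  move=> a Aa; rewrite (AE _ Aa) lecE /= eqxx /=.
  apply: (sup_upper_bound Bsup); by rewrite /B /= -(AE _ Aa).
move=> b ubb; case: A0 => a Aa.
have := ubb _ Aa; rewrite (AE _ Aa); case: b ubb => x y ubb.
rewrite !lecE /= => /andP[-> _] /=.
apply: ge_sup; first by case: Bsup.
by move=> r Br; have := ubb _ Br; rewrite lecE /= => /andP[_].
Qed.

Section BoundedOperators.
Context {K : numFieldType}.
Implicit Types V W : normedModType K.

Definition bounded_operator V W (f : {linear V -> W}) :=
  exists M, forall x, `|f x| <= M * `|x|.

Definition opnorm V W (f : {linear V -> W}) : K :=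
  supremum 0 [set `|f x| | x in [set x : V | `|x| <= 1]].

Definition linear_isometry V W (f : {linear V -> W}) := forall x, `|f x| = `|x|.

Lemma isometry_bounded V W (f : {linear V -> W}) :
  linear_isometry f -> bounded_operator f.
Proof. by move=> fV; exists 1 => x; rewrite mul1r fV. Qed.

Definition unit_sphere V : set V := [set x | `|x| = 1].

Definition dual_unit_sphere V : set {linear V -> K^o} :=
  [set phi | bounded_operator phi /\ opnorm phi = 1].

Definition norming_functionals V (u : V) : set {linear V -> K^o} :=
  [set phi | dual_unit_sphere phi /\ phi u = 1].

Definition finite_dimensional V :=
  exists (n : nat) (e : 'I_n -> V),
    forall x, exists c : 'I_n -> K, x = \sum_(i < n) c i *: e i.

Definition closed_convex_hull V (A : set V) : set V :=
  smallest [set C : set V | closed C /\ convex_set C] A.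

End BoundedOperators.
Arguments unit_sphere {K} V.

Section BoundedFunctions.
Context {R : realType} {k : scalar_kind}.
Local Notation K := (scalars R k).
Variables (T : Type) (V : normedModType K).

Definition bounded_fun_pred : {pred T -> V} :=
  mem (bounded_fun : set (T -> V)).

Lemma bounded_fun_predP (f : T -> V) :
  reflect (exists M, forall x, `|f x| <= M) (f \in bounded_fun_pred).
Proof.
apply: (iffP idP) => [|[M fM]]; rewrite inE /=.
  by move=> /pinfty_ex_gt0[M _ fM]; exists M => x; exact: fM.
case: (pselect (exists x : T, True)) => [[x _]|T0]; last first.
  by apply: nearW => N y; case: T0; exists y.
have Mreal : M \is Num.real by rewrite ger0_real// (le_trans _ (fM x)).
by exists M; split => // N /ltW MN y _; exact: (le_trans (fM y)).
Qed.

Lemma bounded_fun_pred_submod : submod_closed bounded_fun_pred.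
Proof.
split; first by apply/bounded_fun_predP; exists 0 => x; rewrite normr0.
move=> a f g /bounded_fun_predP[M fM] /bounded_fun_predP[N gN].
apply/bounded_fun_predP; exists (`|a| * M + N) => x.
rewrite (le_trans (ler_normD _ _))// lerD// normrZ.
by rewrite ler_wpM2l.
Qed.

HB.instance Definition _ :=
  GRing.isSubmodClosed.Build K (T -> V) bounded_fun_pred
    bounded_fun_pred_submod.

(* The space B(T, V) of bounded functions from T to V. *)
Record bfun := BFun {
  bfun_val :> T -> V ;
  bfun_valP : bfun_val \in bounded_fun_pred }.

HB.instance Definition _ := [isSub for bfun_val].
HB.instance Definition _ := [Choice of bfun by <:].
HB.instance Definition _ := [SubChoice_isSubLmodule of bfun by <:].

Definition sup_norm (f : bfun) : K := supremum 0 [set `|f x| | x in [set: T]].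

Lemma sup_norm_ge (f : bfun) x : `|f x| <= sup_norm f.
Proof.
have [M fM] := bounded_fun_predP _ (bfun_valP f).
have [|||ub _] := @scalars_supremum R k [set `|f x| | x in [set: T]].
- by exists `|f x|, x.
- by move=> _ [y _ <-].
- by exists M => _ [y _ <-].
by apply: ub; exists x.
Qed.

Lemma sup_norm_le (f : bfun) (M : K) :
  0 <= M -> (forall x, `|f x| <= M) -> sup_norm f <= M.
Proof.
move=> M0 fM; case: (pselect (exists x : T, True)) => [[x _]|T0]; last first.
  rewrite /sup_norm (_ : [set _ | _ in _] = set0) ?supremum0//.
  by rewrite -subset0 => z [y]; case: T0; exists y.
have [|||_ lb] := @scalars_supremum R k [set `|f x| | x in [set: T]].
- by exists `|f x|, x.
- by move=> _ [y _ <-].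
- by exists M => _ [y _ <-].
by apply: lb => _ [y _ <-].
Qed.

Lemma sup_norm_ge0 (f : bfun) : 0 <= sup_norm f.
Proof.
case: (pselect (exists x : T, True)) => [[x _]|T0].
  exact: (le_trans _ (sup_norm_ge f x)).
rewrite /sup_norm (_ : [set _ | _ in _] = set0) ?supremum0//.
by rewrite -subset0 => z [y]; case: T0; exists y.
Qed.

Lemma sup_normD (f g : bfun) : sup_norm (f + g) <= sup_norm f + sup_norm g.
Proof.
apply: sup_norm_le => [|x]; first by rewrite addr_ge0// sup_norm_ge0.
by rewrite (le_trans (ler_normD _ _))// lerD// sup_norm_ge.
Qed.

Lemma sup_normZ (a : K) (f : bfun) : sup_norm (a *: f) = `|a| * sup_norm f.
Proof.
apply/eqP; rewrite eq_le; apply/andP; split.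
  apply: sup_norm_le => [|x]; first by rewrite mulr_ge0// sup_norm_ge0.
  by rewrite /= normrZ ler_wpM2l// sup_norm_ge.
have [->|a0] := eqVneq a 0; first by rewrite normr0 mul0r sup_norm_ge0.
have a0' : 0 < `|a| by rewrite normr_gt0.
rewrite mulrC -ler_pdivlMr//; apply: sup_norm_le => [|x].
  by rewrite divr_ge0// sup_norm_ge0.
rewrite ler_pdivlMr// mulrC -normrZ.
exact: (sup_norm_ge (a *: f)).
Qed.

Lemma sup_norm0_eq0 (f : bfun) : sup_norm f = 0 -> f = 0.
Proof.
move=> f0; apply/val_inj/funext => x; apply/eqP.
by rewrite -normr_le0 -f0 sup_norm_ge.
Qed.

HB.instance Definition _ :=
  Lmodule_isNormed.Build K bfun sup_normD sup_normZ sup_norm0_eq0.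

End BoundedFunctions.

Section NumericalRanges.
Context {R : realType} {k : scalar_kind}.
Local Notation K := (scalars R k).
Variables (X Y : normedModType K).

Lemma restrict_subproof (f : {linear X -> Y}) : bounded_operator f ->
  (fun x : unit_sphere X => f (val x)) \in @bounded_fun_pred R k _ Y.
Proof.
move=> [M fM]; apply/bounded_fun_predP; exists M => -[x /= xS].
by move: xS (fM x); rewrite inE /unit_sphere/= => ->; rewrite mulr1.
Qed.

Definition restrict_sphere (f : {linear X -> Y}) (bf : bounded_operator f) :
    bfun (unit_sphere X) Y :=
  BFun (restrict_subproof bf).

Definition norming_pairs (J : {linear X -> Y}) :
    set (unit_sphere X * {linear Y -> K^o}) :=
  [set p | norming_functionals (J (val p.1)) p.2].

Definition spatial_range (J : {linear X -> Y}) (f : bfun (unit_sphere X) Y) :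
    set K^o :=
  [set p.2 (f p.1) | p in norming_pairs J].

Definition intrinsic_range (J : {linear X -> Y}) (isoJ : linear_isometry J)
    (f : bfun (unit_sphere X) Y) : set K^o :=
  [set Phi f | Phi in
    norming_functionals (restrict_sphere (isometry_bounded isoJ))].

End NumericalRanges.

(* Main.v *)
From HB Require Import structures.
Require Import Defs.
From mathcomp Require Import all_boot all_order all_algebra complex.
From mathcomp Require Import all_classical all_reals all_analysis.
From mathcomp Require Import ring lra.
Set Implicit Arguments.
Unset Strict Implicit.
Unset Printing Implicit Defensive.

(** The theorem follows from a property of [X] alone: there are functionals
    [g n] of norm at most 1 and unit vectors [x n] with [g n (x n)] tending
    to 1, such that [sup_n |g n y| < 1] for every single unit vector [y]
    (lemma [nonattaining_functionals]).  Given these, let [Y] be the space of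
    bounded sequences in [X], let [u] be a unit vector of [X], and put
      J y = (y, g 0 y *: u, g 1 y *: u, ...),
      T y = (0, g 0 y *: u, g 1 y *: u, ...).
    For a unit vector [y] and small [a] one has [|J y + a *: T y| = 1], since
    all coordinates of [J y] but the first stay below the norm by a fixed
    amount; so every functional that norms [J y] kills [T y], and the spatial
    range is contained in {0} ([spatial_value_eq0]).  However, no [a] is small
    enough for the whole sphere: a limit of evaluations at [x n] in the
    coordinate [n + 1] is a norm one functional that takes the value 1 both at
    [J] and at [T], so 1 belongs to the intrinsic range ([intrinsic_value1]).

    A normalized weak-star null sequence of functionals, as provided by the
    Josefson-Nissenzweig theorem, would give such [g n] after multiplication
    by weights that increase to 1.  It is enough, and easier, to find almost
    normalized functionals whose values at each point of the ball are
    eventually at most 1/2 ([slack_sequence]).  Suppose that there are none.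
    Then every sequence of functionals with norms at least [a] exceeds [a / 2]
    in absolute value infinitely often at some fixed point of the ball
    ([recurrent_point]).
    This assumption is turned against itself.  In infinite dimension there is
    a separated sequence in the dual, and it has a subsequence [f] whose tails
    stay away from every element of its midpoint hull
    ([separated_subsequence]).  Therefore every sequence of averages of later
    and later terms of [f] oscillates, by a fixed amount, at some point of the
    ball ([splitting_point]).  Averaging the two alternatives of such an
    oscillation and repeating yields, as half differences, functionals that
    imitate Rademacher functions: each is at least 1/16 at its own point, while
    the sum of their squares is at most 1 at every point of the ball
    ([rademacher_array]).  A limit along an ultrafilter gives an infinite
    sequence with both properties, and such a sequence has no recurrent point
    ([no_bessel_sequence]). *)

Import Order.TTheory GRing.Theory Num.Theory.
Import numFieldNormedType.Exports.

Local Open Scope classical_set_scope.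
Local Open Scope ring_scope.

(** * Diagonal subsequences *)

(** Index maps are only required to tend to infinity.  This relaxed notion is
    insensitive to finitely many terms, which makes it a preorder in which a
    diagonal sequence lies below every sequence that it was drawn from. *)
Definition subsequence A (u f : nat -> A) :=
  forall m, exists K, forall k, (K <= k)%N -> exists2 i, (m <= i)%N & u k = f i.

Lemma subsequence_refl A (f : nat -> A) : subsequence f f.
Proof. by move=> m; exists m => k mk; exists k. Qed.

Lemma subsequence_trans A (u v w : nat -> A) :
  subsequence u v -> subsequence v w -> subsequence u w.
Proof.
move=> uv vw m; have [K vwK] := vw m; have [L uvL] := uv K.
by exists L => k /uvL[i Ki ->]; exact: vwK.
Qed.

(** The diagonal argument for a countable list of properties, each of which
    passes to subsequences and can be achieved on a subsequence. *)
Lemma subsequence_diagonal A (P : nat -> (nat -> A) -> Prop) (f : nat -> A) :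
  (forall m u v, subsequence v u -> P m u -> P m v) ->
  (forall m u, subsequence u f -> exists v, subsequence v u /\ P m v) ->
  exists g, subsequence g f /\ forall m, P m g.
Proof.
move=> Psub Pdense.
have /choice[ext extP] : forall mu : nat * (nat -> A), exists v,
    subsequence mu.2 f -> subsequence v mu.2 /\ P mu.1 v.
  move=> [m u]; have [uf|nuf] := pselect (subsequence u f).
    by have [v vP] := Pdense m u uf; exists v.
  by exists u.
pose F := fix F n := if n is m.+1 then ext (m, F m) else f.
have Ff n : subsequence (F n) f.
  elim: n => [|n IH]; first exact: subsequence_refl.
  by have [+ _] := extP (n, F n) IH; move/subsequence_trans; exact.
have FF n m : (m <= n)%N -> subsequence (F n) (F m).
  elim: n => [|n IH]; first by rewrite leqn0 => /eqP->; exact: subsequence_refl.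
  rewrite leq_eqVlt => /predU1P[->|]; first exact: subsequence_refl.
  rewrite ltnS => /IH; apply: subsequence_trans.
  by have [] := extP (n, F n) (Ff n).
have tails k b : (b <= k.+1)%N -> exists K, forall i, (K <= i)%N ->
    forall m, (m < b)%N -> exists2 j, (k <= j)%N & F k i = F m j.
  elim: b => [_|b IH bk]; first by exists 0%N.
  have [K HK] := IH (ltnW bk); have [L HL] := FF k b bk k.
  exists (maxn K L) => i; rewrite geq_max => /andP[Ki Li] m.
  rewrite ltnS leq_eqVlt => /predU1P[->|]; [exact: HL|exact: HK].
have /choice[d dP] : forall k, exists d, forall m, (m < k.+1)%N ->
    exists2 j, (k <= j)%N & F k d = F m j.
  move=> k; have [K HK] := tails k k.+1 (leqnn _).
  by exists K; exact: HK.
have gF m : subsequence (fun k => F k (d k)) (F m).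
  move=> p; exists (maxn m p) => k; rewrite geq_max => /andP[mk pk].
  by have [j kj ->] := dP k m mk; exists j => //; exact: leq_trans kj.
exists (fun k => F k (d k)); split=> [|m]; first exact: gF 0%N.
by apply: (Psub m (F m.+1)); [exact: gF|have [] := extP (m, F m) (Ff m)].
Qed.

(** * Generalized limits of bounded sequences *)

Section UltraLimit.
Context {R : realType}.

Definition bounded_seq (a : nat -> R) := exists C, forall n, `|a n| <= C.

Record generalized_limit (L : (nat -> R) -> R) : Prop := GeneralizedLimit {
  glim_add : forall a b, bounded_seq a -> bounded_seq b ->
    L (fun n => a n + b n) = L a + L b ;
  glim_scale : forall c a, bounded_seq a -> L (fun n => c * a n) = c * L a ;
  glim_ge : forall c a, bounded_seq a ->
    (exists K, forall n, (K <= n)%N -> c <= a n) -> c <= L a }.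

(** The limit along a free ultrafilter, which exists by compactness of
    segments. *)
Lemma generalized_limit_exists : exists L, generalized_limit L.
Proof.
have [U [UU sU]] := @ultraFilterLemma nat \oo _.
have PU : ProperFilter U := ultra_proper.
have cvgU a : bounded_seq a -> (a @ U --> lim (a @ U)).
  move=> [C aC].
  have : compact `[- C, C]%classic by exact: segment_compact.
  have FU : UltraFilter (a @ U).
    split; first exact: fmap_proper_filter.
    move=> G PG sG; rewrite eqEsubset; split => // A GA.
    have [//|UnA] := in_ultra_setVsetC (a @^-1` A) UU.
    have /sG GnA : (a @ U) (~` A) by [].
    by case: (@filter_not_empty _ G PG); rewrite -(setICr A); exact: filterI.
  rewrite compact_ultra => /(_ (a @ U) FU)[].
    by apply: nearW => n /=; rewrite in_itv /= -ler_norml.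
  by move=> l [_ al]; apply/cvg_ex; exists l.
exists (fun a => lim (a @ U)); split.
- by move=> a b /cvgU ca /cvgU cb; apply/cvg_lim => //; exact: cvgD.
- by move=> c a /cvgU ca; apply/cvg_lim => //; exact: cvgMr.
- move=> c a /cvgU ca [K cK]; apply: limr_ge.
    by apply/cvg_ex; eexists; exact: ca.
  by apply: sU; exists K => // n /=; exact: cK.
Qed.

Lemma bounded_seqD a b : bounded_seq a -> bounded_seq b ->
  bounded_seq (fun n => a n + b n).
Proof.
move=> [C aC] [D bD]; exists (C + D) => n.
by rewrite (le_trans (ler_normD _ _))// lerD.
Qed.

Lemma bounded_seqZ c a : bounded_seq a -> bounded_seq (fun n => c * a n).
Proof. by move=> [C aC]; exists (`|c| * C) => n; rewrite normrM ler_wpM2l. Qed.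

Variables (L : (nat -> R) -> R) (HL : generalized_limit L).

Lemma glim_le c a : bounded_seq a ->
  (exists K, forall n, (K <= n)%N -> a n <= c) -> L a <= c.
Proof.
move=> ba [K ac]; rewrite -lerN2 -[- L a]mulN1r -(glim_scale HL)//.
apply: (glim_ge HL); first exact: bounded_seqZ.
by exists K => n /ac; rewrite mulN1r lerN2.
Qed.

Lemma glim_norm_le c a : (forall n, `|a n| <= c) -> `|L a| <= c.
Proof.
move=> ac; have ba : bounded_seq a by exists c.
rewrite ler_norml; apply/andP; split.
  apply: (glim_ge HL) => //; exists 0%N => n _.
  by have := ac n; rewrite ler_norml => /andP[].
apply: glim_le => //; exists 0%N => n _.
by have := ac n; rewrite ler_norml => /andP[].
Qed.

End UltraLimit.

(** * Functionals and recurrent points *)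

(** This part and the next two are written over the reals, for a seminorm given
    as a function [N] on a real vector space; over the complex numbers they are
    applied to real parts of functionals. *)
Section Functionals.
Context {R : realType} {V : lmodType R}.
Variable N : V -> R.
Hypothesis N_ge0 : forall x, 0 <= N x.
Hypothesis NZ : forall a x, N (a *: x) = `|a| * N x.
Implicit Types (phi psi h : V -> R) (u v e f : nat -> V -> R).

Definition functional phi :=
  [/\ forall x y, phi (x + y) = phi x + phi y,
      forall a x, phi (a *: x) = a * phi x
    & exists C, forall x, `|phi x| <= C * N x].

Definition contraction phi := functional phi /\ forall x, `|phi x| <= N x.

Definition midpoint phi psi : V -> R := fun x => (phi x + psi x) / 2.

Lemma functional_comb a b phi psi : functional phi -> functional psi ->
  functional (fun x => a * phi x + b * psi x).
Proof.
move=> [pD pZ [C pC]] [qD qZ [D qD']]; split.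
- by move=> x y; rewrite pD qD; ring.
- by move=> c x; rewrite pZ qZ; ring.
- exists (`|a| * C + `|b| * D) => x; rewrite (le_trans (ler_normD _ _))//.
  by rewrite mulrDl !normrM -!mulrA lerD// ler_wpM2l.
Qed.

Lemma functional_sub phi psi : functional phi -> functional psi ->
  functional (fun x => phi x - psi x).
Proof.
move=> Fp Fq; rewrite (_ : (fun _ => _) = fun x => 1 * phi x + (- 1) * psi x).
  exact: functional_comb.
by apply/funext => x; ring.
Qed.

Lemma functional_scale a phi :
  functional phi -> functional (fun x => a * phi x).
Proof.
move=> Fp; rewrite (_ : (fun _ => _) = fun x => a * phi x + 0 * phi x).
  exact: functional_comb.
by apply/funext => x; ring.
Qed.

Lemma contraction_midpoint phi psi : contraction phi -> contraction psi ->
  contraction (midpoint phi psi).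
Proof.
move=> [Fp pN] [Fq qN]; split.
  rewrite (_ : midpoint _ _ = fun x => 2^-1 * phi x + 2^-1 * psi x).
    exact: functional_comb.
  by apply/funext => x; rewrite /midpoint; field.
move=> x; have := pN x; have := qN x; rewrite /midpoint !ler_norml.
by move=> /andP[? ?] /andP[? ?]; apply/andP; split; lra.
Qed.

Lemma functional_ball phi c : functional phi ->
  (forall x, N x <= 1 -> `|phi x| <= c) -> forall x, `|phi x| <= c * N x.
Proof.
move=> [_ pZ [C pC]] pc x; have [Nx0|Nx0] := eqVneq (N x) 0.
  by have := pC x; rewrite Nx0 !mulr0.
have Nx : 0 < N x by rewrite lt_def Nx0 N_ge0.
have := pc ((N x)^-1 *: x); rewrite NZ pZ normrM normfV (ger0_norm (N_ge0 x)).
rewrite mulVf// => /(_ (lexx _)).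
by rewrite mulrC ler_pdivrMr.
Qed.

(** A weak form of the conclusion of the Josefson-Nissenzweig theorem: the norms
    tend to 1, but at each point of the ball the values are eventually at most
    1/2 instead of tending to 0. *)
Definition slack_sequence (phi : nat -> V -> R) :=
  [/\ forall n, contraction (phi n),
    forall n, exists x, N x <= 1 /\ 1 - n.+1%:R^-1 <= `|phi n x|
  & forall x, N x <= 1 -> exists K, forall n, (K <= n)%N -> `|phi n x| <= 2^-1].

Section NoSlack.
Hypothesis noslack : forall phi : nat -> V -> R, ~ slack_sequence phi.

(** If no sequence has slack, normalizing [psi] gives a sequence which violates
    the last clause of [slack_sequence] at some point; that point sees a fixed
    proportion of the norm of infinitely many [psi n].  This is the only way in
    which the absence of slack is used. *)
Lemma recurrent_point (psi : nat -> V -> R) a : 0 < a ->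
  (forall n, functional (psi n)) ->
  (forall n, exists x, N x <= 1 /\ a <= `|psi n x|) ->
  exists x, N x <= 1 /\ forall m, exists n, (m <= n)%N /\ a / 2 < `|psi n x|.
Proof.
move=> a0 Fpsi psia; pose S n := [set `|psi n x| | x in [set x | N x <= 1]].
have supS n : has_sup (S n).
  split; first by have [x [Nx _]] := psia n; exists `|psi n x|, x.
  have [_ _ [C pC]] := Fpsi n; exists `|C| => _ [x /= Nx <-].
  apply: (le_trans (pC x)); apply: (le_trans (ler_norm _)).
  by rewrite normrM (ger0_norm (N_ge0 x)) ler_piMr.
have Sub n x : N x <= 1 -> `|psi n x| <= sup (S n).
  by move=> Nx; apply: (sup_upper_bound (supS n)); exists x.
have Sa n : a <= sup (S n).
  by have [x [Nx ax]] := psia n; exact: (le_trans ax (Sub n x Nx)).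
have S0 n : 0 < sup (S n) by exact: lt_le_trans (Sa n).
pose phi n x := (sup (S n))^-1 * psi n x.
have nphi n x : `|phi n x| = `|psi n x| / sup (S n).
  by rewrite normrM normfV (gtr0_norm (S0 n)) mulrC.
have Fphi n : functional (phi n) by exact: functional_scale.
apply: contrapT => none; apply: (noslack (phi := phi)); split.
- move=> n; split=> // x; rewrite -[leRHS]mul1r.
  apply: functional_ball => // y Ny; rewrite nphi ler_pdivrMr// mul1r.
  exact: Sub.
- move=> n; have e0 : 0 < n.+1%:R^-1 * sup (S n).
    by rewrite mulr_gt0// invr_gt0.
  have [_ [x /= Nx <-] lt] := sup_adherent e0 (supS n).
  exists x; split => //; rewrite nphi ler_pdivlMr// mulrBl mul1r.
  exact: ltW.
- move=> x Nx; apply: contrapT => nK; apply: none; exists x; split=> // m.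
  apply: contrapT => nm; apply: nK; exists m => n mn.
  rewrite nphi ler_pdivrMr//; have [//|lt] := leP; exfalso; apply: nm.
  exists n; split=> //; apply: le_lt_trans lt.
  by rewrite mulrC ler_wpM2l// invr_ge0.
Qed.

(** Midpoints alone suffice below, and unlike the convex hull with real weights
    the midpoint hull of a sequence is countable. *)
Inductive hull (S : set (V -> R)) : set (V -> R) :=
| hull_in phi : S phi -> hull S phi
| hull_mid phi psi : hull S phi -> hull S psi -> hull S (midpoint phi psi).

Lemma hull_min (S P : set (V -> R)) : S `<=` P ->
  (forall phi psi, P phi -> P psi -> P (midpoint phi psi)) -> hull S `<=` P.
Proof.
by move=> SP Pmid h; elim=> [phi /SP//|phi psi _ ? _ ?]; exact: Pmid.
Qed.

Lemma hull_sub (S T : set (V -> R)) : S `<=` hull T -> hull S `<=` hull T.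
Proof. by move=> ST; apply: hull_min => // phi psi; exact: hull_mid. Qed.

(** An enumeration of the midpoint hull of [e]: binary trees are encoded among
    the generic trees because these form a countable type.  Trees with a node
    that is not binary get an arbitrary value. *)
Fixpoint tree_midpoint e (t : GenTree.tree nat) : V -> R :=
  match t with
  | GenTree.Leaf n => e n
  | GenTree.Node _ [:: a; b] => midpoint (tree_midpoint e a) (tree_midpoint e b)
  | _ => e 0
  end.

Lemma hull_tree e h : hull (range e) h -> exists t, h = tree_midpoint e t.
Proof.
elim=> [_ [n _ <-]|phi psi _ [a ->] _ [b ->]]; first by exists (GenTree.Leaf n).
by exists (GenTree.Node 0 [:: a; b]).
Qed.

Lemma tree_midpoint_contraction e t :
  (forall n, contraction (e n)) -> contraction (tree_midpoint e t).
Proof.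
move=> Ce; move: t; fix IH 1 => -[n|n [|a [|b [|]]]] //=.
by apply: contraction_midpoint; exact: IH.
Qed.

(** A gap between [h] and the tail of [f] at a single point, with constant
    sign.  The constant sign makes this a pair of half-space conditions, hence
    inherited by every sequence in the hulls of the tails of [f]. *)
Definition separated_at f h x :=
  (exists K, forall k, (K <= k)%N -> h x + 4^-1 <= f k x) \/
  (exists K, forall k, (K <= k)%N -> f k x <= h x - 4^-1).

Lemma separated_at_sub f g h x :
  subsequence g f -> separated_at f h x -> separated_at g h x.
Proof.
move=> gf [|] [K fK]; have [L gL] := gf K; [left|right]; exists L => k /gL;
  by move=> [i Ki ->]; exact: fK.
Qed.

(** A separated sequence has a subsequence whose tails stay away from each
    element [h] of its hull, at a point depending only on [h].  At most one
    term of [e] is within 1/2 of a given [h], so that [recurrent_point] applied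
    to [e n - h] gives the point for a subsequence; as the hull is countable, a
    diagonal subsequence serves all [h] together. *)
Lemma separated_subsequence e : (forall n, contraction (e n)) ->
  (forall m n, (m < n)%N -> exists x, N x <= 1 /\ 1 <= `|e n x - e m x|) ->
  exists f, (forall k, contraction (f k)) /\
    forall h, hull (range f) h -> exists x, N x <= 1 /\ separated_at f h x.
Proof.
move=> Ce esep.
pose P (m : nat) u := forall t, unpickle m = Some t ->
  exists x, N x <= 1 /\ separated_at u (tree_midpoint e t) x.
have [g [ge gP]] : exists g, subsequence g e /\ forall m, P m g.
  apply: subsequence_diagonal.
    move=> m u v vu uP t /uP[x [Nx ux]]; exists x; split=> //.
    exact: separated_at_sub ux.
  move=> m u ue; rewrite /P; case: (unpickle m) => [t|]; last first.
    by exists u; split=> //; exact: subsequence_refl.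
  set h := tree_midpoint e t.
  have Fh : functional h by have [] := tree_midpoint_contraction t Ce.
  have [K uK] : exists K, forall k, (K <= k)%N -> functional (u k) /\
      exists x, N x <= 1 /\ 2^-1 <= `|u k x - h x|.
    have [[n0 n0h]|far] := pselect (exists n0, forall x, N x <= 1 ->
        `|e n0 x - h x| < 2^-1).
      have [K uK] := ue n0.+1; exists K => k /uK[i n0i ->].
      split; first by have [] := Ce i.
      have [x [Nx ix]] := esep _ _ n0i; exists x; split=> //.
      have /= := ler_distD (h x) (e i x) (e n0 x).
      by have := n0h x Nx; rewrite (distrC (e n0 x)); lra.
    have [K uK] := ue 0%N; exists K => k /uK[i _ ->].
    split; first by have [] := Ce i.
    apply: contrapT => ni; apply: far; exists i => x Nx.
    by rewrite ltNge; apply/negP => ix; apply: ni; exists x.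
  pose psi k x := u (K + k)%N x - h x.
  have [|||x [Nx xP]] := @recurrent_point psi 2^-1.
  - by rewrite invr_gt0.
  - move=> k; apply: functional_sub => //.
    by have [] := uK (K + k)%N (leq_addr _ _).
  - by move=> k; have [] := uK (K + k)%N (leq_addr _ _).
  have [pos|npos] := pselect (forall m, exists n, (m <= n)%N /\ 4^-1 < psi n x).
    have [s sP] := choice pos; exists (fun k => u (K + s k)%N); split.
      move=> p; exists p => k pk; exists (K + s k)%N => //.
      by rewrite (leq_trans pk)// (leq_trans (sP k).1)// leq_addl.
    move=> _ [<-]; exists x; split=> //; left; exists 0%N => k _.
    by have := (sP k).2; rewrite /psi -/h; lra.
  have [m0 m0P] : exists m0, forall n, (m0 <= n)%N -> psi n x <= 4^-1.
    apply: contrapT => nm; apply: npos => p; apply: contrapT => np; apply: nm.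
    exists p => n pn; rewrite leNgt; apply/negP => lt; apply: np.
    by exists n.
  have /choice[s sP] : forall m, exists n, (m <= n)%N /\ psi n x < - 4^-1.
    move=> p; have [n []] := xP (maxn p m0); rewrite geq_max => /andP[pn mn].
    move=> lt; exists n; split=> //; move: lt; have := m0P n mn.
    by rewrite ltr_normr => ? /orP[]; lra.
  exists (fun k => u (K + s k)%N); split.
    move=> p; exists p => k pk; exists (K + s k)%N => //.
    by rewrite (leq_trans pk)// (leq_trans (sP k).1)// leq_addl.
  move=> _ [<-]; exists x; split=> //; right; exists 0%N => k _.
  by have := (sP k).2; rewrite /psi -/h; lra.
have [K gK] := ge 0%N.
have shiftg : subsequence (fun k => g (K + k)%N) g.
  move=> p; exists p => k pk; exists (K + k)%N => //.
  by rewrite (leq_trans pk)// leq_addl.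
exists (fun k => g (K + k)%N); split.
  by move=> k; have [i _ ->] := gK (K + k)%N (leq_addr _ _).
move=> h hg; have /hull_tree[t ht] : hull (range e) h.
  apply: hull_sub hg => _ [k _ <-]; apply: hull_in.
  by have [i _ ->] := gK (K + k)%N (leq_addr _ _); exists i.
have [x [Nx xP]] := gP (pickle t) t (pickleK t).
by exists x; split=> //; rewrite ht; exact: separated_at_sub xP.
Qed.

End NoSlack.
End Functionals.

(** * The doubling construction *)

Lemma ler_sum_prefix (R : numDomainType) (F : nat -> R) (m n : nat) :
  (m <= n)%N -> (forall i, 0 <= F i) -> \sum_(i < m) F i <= \sum_(i < n) F i.
Proof.
move=> /subnKC <- F0; elim: (n - m)%N => [|k IH]; first by rewrite addn0.
by rewrite addnS big_ord_recr/= (le_trans IH)// lerDl.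
Qed.

Section Doubling.
Context {R : realType} {V : lmodType R}.
Variable N : V -> R.
Hypothesis N_ge0 : forall x, 0 <= N x.
Hypothesis NZ : forall a x, N (a *: x) = `|a| * N x.
Hypothesis noslack : forall phi : nat -> V -> R, ~ slack_sequence N phi.
Variable f : nat -> V -> R.
Hypothesis Cf : forall k, contraction N (f k).
Hypothesis fsep : forall h, hull (range f) h ->
  exists x, N x <= 1 /\ separated_at f h x.

(** The class of sequences on which the doubling operates: it contains [f], it
    is stable under midpoints of far terms, and its members inherit the gaps
    given by [fsep]. *)
Definition hull_subsequence (u : nat -> V -> R) :=
  (forall k, contraction N (u k)) /\
  forall m, exists K, forall k, (K <= k)%N ->
    hull [set f i | i in [set i | (m <= i)%N]] (u k).

Lemma hull_subsequence_id : hull_subsequence f.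
Proof. by split=> // m; exists m => k mk; apply: hull_in; exists k. Qed.

Lemma hull_subsequence_midpoint u (j k : nat -> nat) : hull_subsequence u ->
  (forall i, (i <= j i)%N) -> (forall i, (i <= k i)%N) ->
  hull_subsequence (fun i => midpoint (u (j i)) (u (k i))).
Proof.
move=> [Cu uf] ij ik; split=> [i|m]; first exact: contraction_midpoint.
have [K uK] := uf m; exists K => i Ki.
by apply: hull_mid; apply: uK; apply: leq_trans Ki _.
Qed.

Lemma hull_subsequence_far u j : hull_subsequence u ->
  hull (range f) (u j) -> exists K, forall k, (K <= k)%N ->
    exists x, N x <= 1 /\ 4^-1 <= `|u k x - u j x|.
Proof.
move=> [Cu uf] /fsep[x [Nx [|] [m fm]]]; have [K uK] := uf m;
  exists K => k /uK uk; exists x; split=> //.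
  have : u j x + 4^-1 <= u k x; last by have := ler_norm (u k x - u j x); lra.
  apply: (@hull_min _ _ _ [set phi | u j x + 4^-1 <= phi x] _ _ _ uk).
    by move=> _ [i mi <-]; exact: fm.
  by rewrite /midpoint/= => phi psi; lra.
have : u k x <= u j x - 4^-1; last first.
  by have := ler_norm (- (u k x - u j x)); rewrite normrN; lra.
apply: (@hull_min _ _ _ [set phi | phi x <= u j x - 4^-1] _ _ _ uk).
  by move=> _ [i mi <-]; exact: fm.
by rewrite /midpoint/= => phi psi; lra.
Qed.

(** Every such sequence [u] oscillates by at least 1/8 at some point of the
    ball, between indices [j i] and [k i] as large as desired.  Indeed [u] is
    separated by 1/4 in norm, and [recurrent_point] turns a sequence of
    differences that are large in norm into differences that are large at one
    common point. *)
Lemma splitting_point u : hull_subsequence u ->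
  exists xjk : V * (nat -> nat) * (nat -> nat), N xjk.1.1 <= 1 /\
    forall i, [/\ (i <= xjk.1.2 i)%N, (i <= xjk.2 i)%N &
      8^-1 <= u (xjk.1.2 i) xjk.1.1 - u (xjk.2 i) xjk.1.1].
Proof.
move=> Hu; have [Cu uf] := Hu; have [K0 uK0] := uf 0%N.
have /choice[s sP] : forall i, exists k, (i <= k)%N /\
    exists x, N x <= 1 /\ 4^-1 <= `|u k x - u (K0 + i)%N x|.
  move=> i; have [|K KP] := @hull_subsequence_far u (K0 + i)%N Hu.
    apply: hull_sub (uK0 _ (leq_addr _ _)) => _ [m _ <-].
    by apply: hull_in; exists m.
  by exists (maxn i K); split; [exact: leq_maxl|apply: KP; exact: leq_maxr].
pose psi i x := u (s i) x - u (K0 + i)%N x.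
have [|||x [Nx xP]] := @recurrent_point _ _ N N_ge0 NZ noslack psi 4^-1.
- by rewrite invr_gt0.
- move=> i; apply: functional_sub; first by have [] := Cu (s i).
  by have [] := Cu (K0 + i)%N.
- by move=> i; have [] := sP i.
have /choice[jk jkP] : forall i, exists jk : nat * nat, [/\ (i <= jk.1)%N,
    (i <= jk.2)%N & 8^-1 <= u jk.1 x - u jk.2 x].
  move=> i; have [n [ni]] := xP i; have [sn _] := sP n.
  have Kn : (i <= K0 + n)%N by rewrite (leq_trans ni)// leq_addl.
  rewrite ltr_normr /psi => /orP[] lt.
    by exists (s n, (K0 + n)%N); split=> //=; [exact: leq_trans sn|lra].
  by exists ((K0 + n)%N, s n); split=> //=; [exact: leq_trans sn|lra].
by exists (x, fst \o jk, snd \o jk); split=> // i; have [] := jkP i; split.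
Qed.

Definition half_difference (phi psi : V -> R) : V -> R :=
  fun x => (phi x - psi x) / 2.

Lemma parallelogram (p q : R) :
  ((p + q) / 2) ^+ 2 + ((p - q) / 2) ^+ 2 = (p ^+ 2 + q ^+ 2) / 2.
Proof. by field. Qed.

Lemma sqr_midpoint_le (p q : R) : ((p + q) / 2) ^+ 2 <= (p ^+ 2 + q ^+ 2) / 2.
Proof. by rewrite -parallelogram lerDl sqr_ge0. Qed.

(** Start from [f] and repeatedly replace [u] by the midpoints of [u (j i)] and
    [u (k i)], where [j] and [k] are given by [splitting_point]; the half
    differences that appear at step [n] are at least 1/16 at the point [x n].
    Carrying the earlier half differences along by the same averaging keeps
    their lower bounds, since these hold for all indices, and by the
    parallelogram identity it does not increase the sum of all the squares at
    any point.  So [r n M] behaves like the [n]-th Rademacher sum, with weights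
    2^-M, of 2^M functionals of norm at most 1, and the last clause is Bessel's
    inequality for it. *)
Lemma rademacher_array : exists (x : nat -> V) (r : nat -> nat -> V -> R),
  [/\ forall n, N (x n) <= 1,
      forall n M, contraction N (r n M),
      forall n M, (n < M)%N -> 16^-1 <= r n M (x n)
    & forall M y, N y <= 1 -> \sum_(n < M) r n M y ^+ 2 <= 1].
Proof.
have /choice[S SP] : forall u, exists xjk : V * (nat -> nat) * (nat -> nat),
    hull_subsequence u -> N xjk.1.1 <= 1 /\
    forall i, [/\ (i <= xjk.1.2 i)%N, (i <= xjk.2 i)%N &
      8^-1 <= u (xjk.1.2 i) xjk.1.1 - u (xjk.2 i) xjk.1.1].
  move=> u; have [/splitting_point[xjk ?]|nu] := pselect (hull_subsequence u).
    by exists xjk.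
  by exists (0, id, id).
(* [(st M).2 n i] is the half difference created at step [n < M], averaged up
   to step [M]; it is set to 0 for [M <= n] so that arrays need no bound. *)
pose X u := (S u).1.1; pose J u := (S u).1.2; pose K u := (S u).2.
pose st := fix st M : (nat -> V -> R) * (nat -> nat -> V -> R) :=
  if M is M'.+1 then
    let: (u, r) := st M' in
    (fun i => midpoint (u (J u i)) (u (K u i)),
     fun n i => if n == M' then half_difference (u (J u i)) (u (K u i))
                else midpoint (r n (J u i)) (r n (K u i)))
  else (f, fun _ _ _ => 0).
pose u M := (st M).1; pose r n M i := (st M).2 n i.
have uS M : u M.+1 = fun i => midpoint (u M (J (u M) i)) (u M (K (u M) i)).
  by rewrite /u /=; case: (st M).
have rS n M i : r n M.+1 i =
    if n == M then half_difference (u M (J (u M) i)) (u M (K (u M) i))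
    else midpoint (r n M (J (u M) i)) (r n M (K (u M) i)).
  by rewrite /u /r /=; case: (st M).
have Hu M : hull_subsequence (u M).
  elim: M => [|M IH]; first exact: hull_subsequence_id.
  have [_ SM] := SP _ IH; rewrite uS.
  by apply: hull_subsequence_midpoint => // i; have [] := SM i.
have rlow n M i : (n < M)%N -> 16^-1 <= r n M i (X (u n)).
  elim: M i => // M IH i; rewrite ltnS leq_eqVlt rS => /predU1P[->|nM].
    rewrite eqxx /half_difference; have [_ /(_ i)[_ _]] := SP _ (Hu M).
    by rewrite -/(X _) -/(J _) -/(K _); lra.
  rewrite (ltn_eqF nM) /midpoint.
  by have := IH (J (u M) i) nM; have := IH (K (u M) i) nM; lra.
have energy M y i : N y <= 1 -> u M i y ^+ 2 + \sum_(n < M) r n M i y ^+ 2 <= 1.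
  move=> Ny; elim: M i => [|M IH] i.
    rewrite big_ord0 addr0 -real_normK ?num_real// exprn_ile1//.
    by have [_ /(_ y)] := Cf i; move=> /le_trans; apply.
  set j := J (u M) i; set k := K (u M) i.
  rewrite big_ord_recr/= rS eqxx uS /midpoint /half_difference -/j -/k.
  have := parallelogram (u M j y) (u M k y); have := IH j; have := IH k.
  have : \sum_(n < M) r n M.+1 i y ^+ 2 <=
      \sum_(n < M) (r n M j y ^+ 2 / 2 + r n M k y ^+ 2 / 2).
    apply: ler_sum => n _; rewrite rS (ltn_eqF (ltn_ord n)) /midpoint.
    by rewrite -mulrDl sqr_midpoint_le.
  by rewrite big_split/= -!mulr_suml; lra.
have Fr n M i : functional N (r n M i).
  elim: M i => [|M IH] i.
    split=> [x y|a x|]; rewrite ?addr0 ?mulr0//.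
    by exists 0 => x; rewrite normr0 mul0r.
  have Fu k : functional N (u M k) by have [/(_ k)[]] := Hu M.
  rewrite rS; case: ifP => _.
    rewrite (_ : half_difference _ _ = fun x => 2^-1 * u M (J (u M) i) x +
      (- 2^-1) * u M (K (u M) i) x); first exact: functional_comb.
    by apply/funext => x; rewrite /half_difference; field.
  rewrite (_ : midpoint _ _ = fun x => 2^-1 * r n M (J (u M) i) x +
      2^-1 * r n M (K (u M) i) x); first exact: functional_comb.
  by apply/funext => x; rewrite /midpoint; field.
have r0 n M i : (M <= n)%N -> r n M i = fun=> 0.
  elim: M i => // M IH i Mn; rewrite rS (gtn_eqF Mn) !IH ?(ltnW Mn)//.
  by apply/funext => y; rewrite /midpoint addr0 mul0r.
exists (fun n => X (u n)), (fun n M => r n M 0%N); split.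
- by move=> n; have [] := SP _ (Hu n).
- move=> n M; split=> // y; rewrite -[leRHS]mul1r.
  apply: functional_ball => // z Nz; have [Mn|nM] := leqP M n.
    by rewrite r0// normr0.
  have := energy M z 0%N Nz; rewrite (bigD1 (Ordinal nM))//= => le1.
  rewrite -(@expr_le1 _ 2)// real_normK ?num_real//; apply: le_trans le1.
  rewrite addrCA lerDl addr_ge0 ?sqr_ge0//.
  by apply: sumr_ge0 => m _; exact: sqr_ge0.
- by move=> n M; exact: rlow.
- move=> M y Ny; apply: le_trans (energy M y 0%N Ny).
  by rewrite lerDr sqr_ge0.
Qed.

(** Square summability at [y] makes [phi n y] tend to 0, so that no point of the
    ball can be recurrent for [phi]. *)
Lemma no_bessel_sequence (x : nat -> V) (phi : nat -> V -> R) (a : R) : 0 < a ->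
  (forall n, functional N (phi n)) -> (forall n, N (x n) <= 1) ->
  (forall n, a <= phi n (x n)) ->
  (forall m y, N y <= 1 -> \sum_(n < m) phi n y ^+ 2 <= 1) -> False.
Proof.
move=> a0 Fphi Nx phia bessel.
have [|y [Ny yP]] := @recurrent_point _ _ N N_ge0 NZ noslack phi a a0 Fphi.
  by move=> n; exists (x n); split=> //; exact: le_trans (phia n) (ler_norm _).
have growth p : exists m, p%:R * (a / 2) ^+ 2 <= \sum_(n < m) phi n y ^+ 2.
  elim: p => [|p [m mP]]; first by exists 0%N; rewrite big_ord0 mul0r.
  have [n [mn yn]] := yP m; exists n.+1.
  rewrite big_ord_recr/= -natr1 mulrDl mul1r.
  apply: lerD; last first.
    rewrite -[leRHS]real_normK ?num_real// ler_sqr ?nnegrE ?(ltW yn)//.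
    by rewrite divr_ge0// ltW.
  apply: (le_trans mP).
  apply: (@ler_sum_prefix _ (fun n => phi n y ^+ 2)) => //.
  by move=> i; exact: sqr_ge0.
have a2 : 0 < (a / 2) ^+ 2 by rewrite exprn_gt0// divr_gt0.
have [m] := growth (Num.bound ((a / 2) ^+ 2)^-1).
have := bessel m y Ny.
have := archi_boundP (ltW (y := ((a / 2) ^+ 2)^-1) _).
rewrite invr_gt0 => /(_ a2); rewrite -(ltr_pM2r a2) mulVf ?gt_eqF//.
lra.
Qed.

(** The limits of [r n M] as [M] grows form a Bessel sequence which remains at
    least 1/16 at [x n]. *)
Lemma doubling_contradiction : False.
Proof.
have [L HL] := @generalized_limit_exists R.
have [x [r [Nx Cr rlow rB]]] := rademacher_array.
pose a n y M := r n M y; pose phi n y := L (a n y).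
have ba n y : bounded_seq (a n y).
  by exists (N y) => M; have [_] := Cr n M; exact.
have phiN n y : `|phi n y| <= N y.
  by apply: (glim_norm_le HL) => M; have [_] := Cr n M; exact.
apply: (@no_bessel_sequence x phi 16^-1) => // [n|n|m y Ny].
- split=> [y z|c y|]; last by exists 1 => y; rewrite mul1r.
    rewrite /phi -(glim_add HL)//; congr L; apply/funext => M.
    by have [[D _ _] _] := Cr n M; exact: D.
  rewrite /phi -(glim_scale HL)//; congr L; apply/funext => M.
  by have [[_ Z _] _] := Cr n M; exact: Z.
- apply: (glim_ge HL) => //; exists n.+1 => M; exact: rlow.
(* A generalized limit need not be multiplicative; Bessel's inequality passes
   to it by comparing the cross terms [phi n y * a n y M] with the squares. *)
pose b k M := \sum_(n < k) phi n y * a n y M.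
have bL k : bounded_seq (b k) /\ L (b k) = \sum_(n < k) phi n y ^+ 2.
  elim: k => [|k [bk Lk]].
    have -> : b 0%N = fun M => 0 * a 0%N y M.
      by apply/funext => M; rewrite /b big_ord0 mul0r.
    by split; [exact: bounded_seqZ|rewrite (glim_scale HL)// mul0r big_ord0].
  have -> : b k.+1 = fun M => b k M + phi k y * a k y M.
    by apply/funext => M; rewrite /b big_ord_recr.
  split; first by apply: bounded_seqD => //; exact: bounded_seqZ.
  rewrite (glim_add HL)//; last exact: bounded_seqZ.
  by rewrite Lk (glim_scale HL)// big_ord_recr/= expr2.
have [bm Lm] := bL m.
have : L (b m) <= (\sum_(n < m) phi n y ^+ 2 + 1) / 2; last by rewrite Lm; lra.
apply: (glim_le HL) => //; exists m => M mM.
have le1 : \sum_(n < m) a n y M ^+ 2 <= 1.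
  apply: le_trans (rB M y Ny).
  by apply: (@ler_sum_prefix _ (fun n => r n M y ^+ 2)) => // i; exact: sqr_ge0.
apply: (@le_trans _ _ (\sum_(n < m) (phi n y ^+ 2 / 2 + a n y M ^+ 2 / 2))).
  apply: ler_sum => n _; have := sqr_ge0 (phi n y - a n y M).
  by rewrite sqrrB; lra.
by rewrite big_split/= -!mulr_suml; lra.
Qed.

End Doubling.

Lemma slack_sequence_exists (R : realType) (V : lmodType R) (N : V -> R)
    (e : nat -> V -> R) :
  (forall x, 0 <= N x) -> (forall a x, N (a *: x) = `|a| * N x) ->
  (forall n, contraction N (e n)) ->
  (forall m n, (m < n)%N -> exists x, N x <= 1 /\ 1 <= `|e n x - e m x|) ->
  exists phi, slack_sequence N phi.
Proof.
move=> N0 NZ Ce esep; apply: contrapT => none.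
have noslack phi : ~ slack_sequence N phi by move=> ?; apply: none; exists phi.
have [f [Cf fsep]] := separated_subsequence N0 NZ noslack Ce esep.
exact: (doubling_contradiction N0 NZ noslack Cf fsep).
Qed.

(** * Norming functionals and separated sequences of functionals *)

Section HahnBanach.
Context {R : realType} {V : lmodType R}.
Implicit Types p q : V -> R.

Definition sublinear p :=
  (forall x y, p (x + y) <= p x + p y) /\
  (forall t x, 0 < t -> p (t *: x) = t * p x).

Lemma sublinear0 p : sublinear p -> p 0 = 0.
Proof.
by move=> [_ /(_ 2 0)]; rewrite scaler0 => /(_ (ltr0Sn _ _)); lra.
Qed.

Lemma sublinear_inf (S : V -> set R) :
  (forall x, S x !=set0) -> (forall x, has_lbound (S x)) ->
  (forall x y a b, S x a -> S y b -> exists2 c, S (x + y) c & c <= a + b) ->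
  (forall t x a, 0 < t -> S x a -> S (t *: x) (t * a)) ->
  sublinear (fun x => inf (S x)).
Proof.
move=> S0 Slb SD SZ.
have lbS x a : S x a -> inf (S x) <= a by move=> Sa; exact: ge_inf.
have inf_glb x c : (forall a, S x a -> c <= a) -> c <= inf (S x).
  by move=> cS; apply: lb_le_inf => //; exact: S0.
have Zle t x : 0 < t -> inf (S (t *: x)) <= t * inf (S x).
  move=> t0; rewrite mulrC -ler_pdivrMr//; apply: (inf_glb _ _) => a Sa.
  by rewrite ler_pdivrMr// mulrC; apply: lbS; exact: SZ.
split=> [x y|t x t0].
  rewrite -lerBlDr; apply: (inf_glb _ _) => a Sa; rewrite lerBlDr -lerBlDl.
  apply: (inf_glb _ _) => b Sb; have [c Sc cab] := SD _ _ _ _ Sa Sb.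
  by rewrite lerBlDl; apply: le_trans cab; exact: lbS.
apply/eqP; rewrite eq_le Zle//=.
have := Zle t^-1 (t *: x); rewrite invr_gt0 => /(_ t0).
by rewrite scalerA mulVf ?gt_eqF// scale1r ler_pdivlMl.
Qed.

(** The largest sublinear [q <= p] such that [q (x + y) = q x + p y] for all
    [x]; in particular [q (- y) <= - p y]. *)
Definition slide p (y x : V) :=
  inf [set p (x + t *: y) - t * p y | t in [set t | 0 <= t]].

Lemma slide_lbound p y x t : sublinear p -> 0 <= t ->
  - p (- x) <= p (x + t *: y) - t * p y.
Proof.
move=> sp t0; have [pD pZ] := sp.
have pty : p (t *: y) = t * p y.
  move: t0; rewrite le_eqVlt => /predU1P[<-|]; last exact: pZ.
  by rewrite scale0r mul0r sublinear0.
by have := pD (x + t *: y) (- x); rewrite addrAC subrr add0r pty; lra.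
Qed.

Lemma slide_le p y x t : sublinear p -> 0 <= t ->
  slide p y x <= p (x + t *: y) - t * p y.
Proof.
move=> sp t0; apply: ge_inf; last by exists t.
by exists (- p (- x)) => _ [s /= s0 <-]; exact: slide_lbound.
Qed.

Lemma sublinear_slide p y : sublinear p -> sublinear (slide p y).
Proof.
move=> sp; have [pD pZ] := sp.
apply: (@sublinear_inf (fun x =>
  [set p (x + t *: y) - t * p y | t in [set t | 0 <= t]])).
- by move=> x; exists (p (x + 0 *: y) - 0 * p y), 0 => //=; exact: lexx.
- by move=> x; exists (- p (- x)) => _ [s /= s0 <-]; exact: slide_lbound.
- move=> x z _ _ [s /= s0 <-] [t /= t0 <-].
  exists (p (x + z + (s + t) *: y) - (s + t) * p y).
    by exists (s + t) => //=; exact: addr_ge0.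
  by rewrite scalerDl addrACA; have := pD (x + s *: y) (z + t *: y); lra.
- move=> s x _ s0 [t /= t0 <-].
  exists (s * t); first by rewrite /= mulr_ge0// ltW.
  by rewrite -scalerA -scalerDr pZ//; ring.
Qed.

(** Zorn's lemma; chains are bounded below by their pointwise infimum. *)
Lemma minimal_sublinear p : sublinear p -> exists2 q, sublinear q &
  (forall x, q x <= p x) /\
  (forall r, sublinear r -> (forall x, r x <= q x) -> forall x, q x <= r x).
Proof.
move=> sp; pose T := {q : V -> R | sublinear q /\ forall x, q x <= p x}.
pose below (q r : T) := `[< forall x, sval r x <= sval q x >].
pose p' : T := exist _ p (conj sp (fun x => lexx _)).
have [|||q qmin] := @ZL_preorder T p' below.
- by move=> q; apply/asboolP.
- move=> q r s /asboolP rq /asboolP qs; apply/asboolP => x.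
  exact: le_trans (qs x) (rq x).
- move=> A Atot; have [[q0 Aq0]|A0] := pselect (A !=set0); last first.
    exists p' => q Aq.
    by exfalso; apply: A0; exists q.
  pose S x := [set sval q x | q in A].
  have Slb x : has_lbound (S x).
    exists (- p (- x)) => _ [[q [sq qp]] _ <-] /=.
    have [qD _] := sq; have := qD x (- x); rewrite subrr (sublinear0 sq).
    by have := qp (- x); lra.
  have sS : sublinear (fun x => inf (S x)).
    apply: sublinear_inf => //.
    - by move=> x; exists (sval q0 x), q0.
    - move=> x y _ _ [q Aq <-] [r Ar <-].
      have [/asboolP rq|/asboolP qr] := Atot _ _ Aq Ar.
        exists (sval r (x + y)); first by exists r.
        have [[rD _] _] := svalP r.
        by have := rD x y; have := rq x; lra.
      exists (sval q (x + y)); first by exists q.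
      have [[qD _] _] := svalP q.
      by have := qD x y; have := qr y; lra.
    - move=> t x _ t0 [q Aq <-]; exists q => //.
      by have [[_ qZ] _] := svalP q; exact: qZ.
  have Sp x : inf (S x) <= p x.
    apply: (@le_trans _ _ (sval q0 x)); last by have [_] := svalP q0.
    by apply: ge_inf => //; exists q0.
  exists (exist _ (fun x => inf (S x)) (conj sS Sp) : T) => q Aq.
  apply/asboolP => x /=.
  by apply: ge_inf => //; exists q.
have [sq qp] := svalP q.
exists (sval q); first by [].
split=> // r sr rq; have rp x : r x <= p x by exact: le_trans (rq x) (qp x).
have /asboolP := qmin (exist _ r (conj sr rp)) ltac:(by apply/asboolP).
exact.
Qed.

(** Minimality forces [q <= slide q y], hence [q x + q y <= q (x + y)]. *)
Lemma minimal_sublinear_linear q : sublinear q ->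
  (forall r, sublinear r -> (forall x, r x <= q x) -> forall x, q x <= r x) ->
  (forall x y, q (x + y) = q x + q y) /\ (forall a x, q (a *: x) = a * q x).
Proof.
move=> sq qmin; have [qD qZ] := sq.
have qD' x y : q (x + y) = q x + q y.
  apply/eqP; rewrite eq_le qD/= -lerBrDr.
  have slq z : slide q y z <= q z.
    by have := slide_le y z sq (lexx 0); rewrite scale0r addr0 mul0r subr0.
  apply: (le_trans (qmin _ (sublinear_slide y sq) slq x)).
  by have := slide_le y x sq ler01; rewrite scale1r mul1r.
have qN x : q (- x) = - q x.
  by have := qD' x (- x); rewrite subrr (sublinear0 sq); lra.
split=> // a x.
have [a0|a0|->] := ltgtP a 0; last by rewrite scale0r mul0r sublinear0.
- rewrite -[a in LHS]opprK scaleNr qN qZ ?oppr_gt0//; ring.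
- exact: qZ.
Qed.

Variable N : V -> R.
Hypothesis N_ge0 : forall x, 0 <= N x.
Hypothesis ND : forall x y, N (x + y) <= N x + N y.
Hypothesis NZ : forall a x, N (a *: x) = `|a| * N x.

(** A minimal sublinear function below [slide N y] is a functional whose value
    at [- y] is at most [- N y]. *)
Lemma norming_functional (y : V) : exists phi, contraction N phi /\ phi y = N y.
Proof.
have sN : sublinear N by split=> // t x t0; rewrite NZ gtr0_norm.
have [q sq [qs qmin]] := minimal_sublinear (sublinear_slide y sN).
have [qD qZ] := minimal_sublinear_linear sq qmin.
have NN x : N (- x) = N x by rewrite -scaleN1r NZ normrN1 mul1r.
have qN x : q (- x) = - q x by rewrite -scaleN1r qZ mulN1r.
have q_le x : q x <= N x.
  apply: (le_trans (qs x)).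
  by have := slide_le y x sN (lexx 0); rewrite scale0r addr0 mul0r subr0.
have q_norm x : `|q x| <= N x.
  by rewrite ler_norml q_le andbT lerNl -qN -(NN x) q_le.
exists q; split; first by split=> //; split=> //; exists 1 => x; rewrite mul1r.
apply/eqP; rewrite eq_le q_le/=.
have := slide_le y (- y) sN ler01; rewrite scale1r mul1r addNr.
by rewrite (sublinear0 sN); have := qs (- y); rewrite qN; lra.
Qed.

(** The common kernel of [n] functionals has codimension at most [n]. *)
Lemma kernel_complement (phi : nat -> V -> R) n :
  (forall i, functional N (phi i)) ->
  exists v : nat -> V, forall x, exists c : nat -> R,
    forall i, (i < n)%N -> phi i (x - \sum_(j < n) c j *: v j) = 0.
Proof.
move=> Fphi.
have phiD i x y : phi i (x + y) = phi i x + phi i y by have [] := Fphi i.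
have phiZ i a x : phi i (a *: x) = a * phi i x by have [] := Fphi i.
have phiN i x : phi i (- x) = - phi i x by rewrite -scaleN1r phiZ mulN1r.
elim: n => [|n [v vP]]; first by exists (fun=> 0) => x; exists (fun=> 0).
have ext (w : V) (d : R) (c : nat -> R) : \sum_(j < n.+1)
    (if j == n :> nat then d else c j) *: (if j == n :> nat then w else v j) =
    \sum_(j < n) c j *: v j + d *: w.
  rewrite big_ord_recr/= eqxx; congr (_ + _); apply: eq_bigr => j _.
  by rewrite (ltn_eqF (ltn_ord j)).
have [[w [w0 wn]]|nw] := pselect (exists w,
    (forall i, (i < n)%N -> phi i w = 0) /\ phi n w != 0);
  [exists (fun j => if j == n then w else v j)|
    exists (fun j => if j == n then 0 else v j)] => x; have [c cP] := vP x.
  pose z := x - \sum_(j < n) c j *: v j.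
  exists (fun j => if j == n then phi n z / phi n w else c j) => i.
  rewrite ext opprD addrA -/z phiD phiN phiZ ltnS leq_eqVlt => /predU1P[->|iln].
    by rewrite divfK// subrr.
  by rewrite (w0 _ iln) mulr0 subr0 cP.
exists (fun j => if j == n then 0 else c j) => i.
rewrite ext scaler0 addr0 ltnS leq_eqVlt => /predU1P[->|]; last exact: cP.
apply: contrapT => /eqP ne; apply: nw; exists (x - \sum_(j < n) c j *: v j).
by split.
Qed.

Hypothesis N_eq0 : forall x, N x = 0 -> x = 0.
Hypothesis infinite_dimensional : forall n (v : nat -> V),
  exists x, forall c : nat -> R, x <> \sum_(j < n) c j *: v j.

(** Each new functional norms a unit vector that the previous ones
    annihilate. *)
Lemma separated_functionals : exists e : nat -> V -> R,
  (forall n, contraction N (e n)) /\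
  (forall m n, (m < n)%N -> exists x, N x <= 1 /\ 1 <= `|e n x - e m x|).
Proof.
have step (phi : nat -> V -> R) n : (forall i, functional N (phi i)) ->
    exists psi, contraction N psi /\ exists x, [/\ N x <= 1, psi x = 1 &
      forall i, (i < n)%N -> phi i x = 0].
  move=> Fphi; have [v vP] := kernel_complement n Fphi.
  have [x xv] := infinite_dimensional n v; have [c cP] := vP x.
  set z := x - _ in cP.
  have Nz : N z != 0.
    by apply/eqP => /N_eq0/eqP; rewrite subr_eq0 => /eqP /xv.
  have Ny : N ((N z)^-1 *: z) = 1.
    by rewrite NZ normfV (ger0_norm (N_ge0 z)) mulVf.
  have [psi [Cpsi psiy]] := norming_functional ((N z)^-1 *: z).
  exists psi; split=> //; exists ((N z)^-1 *: z).
  split; rewrite ?psiy ?Ny// => i iln.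
  by have [_ -> _] := Fphi i; rewrite cP// mulr0.
have F0 : functional N (fun=> 0).
  split=> [x y|a x|]; rewrite ?addr0 ?mulr0//.
  by exists 0 => x; rewrite normr0 mul0r.
have /choice[ext extP] : forall pn : (nat -> V -> R) * nat, exists psi,
    (forall i, functional N (pn.1 i)) ->
    contraction N psi /\ exists x, [/\ N x <= 1, psi x = 1 &
      forall i, (i < pn.2)%N -> pn.1 i x = 0].
  move=> [phi n].
  have [/(step phi n)[psi ?]|nF] := pselect (forall i, functional N (phi i)).
    by exists psi.
  by exists (fun=> 0).
pose st := fix st n : nat -> V -> R := if n is n'.+1 then
  fun i => if i == n' then ext (st n', n') else st n' i else fun _ _ => 0.
have Fst n i : functional N (st n i).
  elim: n i => [|n IH] i //=; case: ifP => // _.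
  by have [[]] := extP (st n, n) IH.
pose e n := ext (st n, n).
have ste n i : (i < n)%N -> st n i = e i.
  elim: n => // n IH; rewrite ltnS leq_eqVlt /= => /predU1P[->|iln].
    by rewrite eqxx.
  by rewrite (ltn_eqF iln) IH.
exists e; split=> [n|m n mn]; first by have [] := extP (st n, n) (Fst n).
have [_ [x [Nx ex st0]]] := extP (st n, n) (Fst n).
exists x; split=> //; rewrite -/(e n) in ex; rewrite ex -(ste n m mn).
have -> : st n m x = 0 by exact: st0.
by rewrite subr0 normr1.
Qed.

Lemma slack_sequence_infinite_dimensional :
  exists phi : nat -> V -> R, slack_sequence N phi.
Proof.
have [e [Ce esep]] := separated_functionals.
exact: slack_sequence_exists Ce esep.
Qed.

End HahnBanach.

(** * Real and complex scalars *)

Section Scalars.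
Context {R : realType}.

Definition of_real (k : scalar_kind) : R -> scalars R k :=
  match k with RealScalars => id | ComplexScalars => real_complex R end.

Definition real_part (k : scalar_kind) : scalars R k -> R :=
  match k with RealScalars => id | ComplexScalars => @complex.Re R end.

(** The value 0 for real scalars makes [re_i_norm_le] hold in both cases. *)
Definition imaginary_unit (k : scalar_kind) : scalars R k :=
  match k with RealScalars => 0 | ComplexScalars => ('i)%C end.

Context {k : scalar_kind}.
Local Notation K := (scalars R k).
Implicit Types (a b : R) (z w : K).
Local Notation ofR := (of_real k).
Local Notation re := (@real_part k).
Local Notation i := (imaginary_unit k).

Lemma of_realD a b : ofR (a + b) = ofR a + ofR b.
Proof. by case: k => //=; exact: rmorphD. Qed.

Lemma of_realM a b : ofR (a * b) = ofR a * ofR b.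
Proof. by case: k => //=; exact: rmorphM. Qed.

Lemma of_real1 : ofR 1 = 1.
Proof. by case: k. Qed.

Lemma of_real0 : ofR 0 = 0.
Proof. by case: k. Qed.

Lemma ler_of_real a b : (ofR a <= ofR b) = (a <= b).
Proof. by case: k => //=; rewrite lecR. Qed.

Lemma norm_of_real a : `|ofR a| = ofR `|a|.
Proof. by case: k => //=; rewrite normc_def /= expr0n addr0 sqrtr_sqr. Qed.

Lemma ge0_of_real z : 0 <= z -> z = ofR (re z).
Proof.
case: k z => //= -[x y]; rewrite lecE /= => /andP[/eqP -> _]; exact: erefl.
Qed.

Lemma reK a : re (ofR a) = a.
Proof. by case: k. Qed.

Lemma reZ a z : re (ofR a * z) = a * re z.
Proof. by case: k z => //= -[x y]; rewrite /= mul0r subr0. Qed.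

Lemma re_le_norm z : ofR `|re z| <= `|z|.
Proof.
case: k z => //= -[x y]; rewrite normc_def/= lecR -sqrtr_sqr.
by apply: ler_wsqrtr; rewrite lerDl sqr_ge0.
Qed.

Lemma norm_imaginary_unit : `|i| <= 1.
Proof. case: k => /=; first by rewrite normr0.
by rewrite normc_def /= expr0n expr1n add0r sqrtr1. Qed.

Lemma re_i_norm_le z : `|re z| <= 2^-1 -> `|re (i * z)| <= 2^-1 ->
  `|z| <= ofR (3 / 4).
Proof.
case: k z => [z zh _|[x y]] /=; first by lra.
rewrite mul0r sub0r mul1r normrN => xh yh; rewrite normc_def/= lecR.
have -> : 3 / 4 = Num.sqrt ((3 / 4) ^+ 2) :> R.
  by rewrite sqrtr_sqr ger0_norm//; lra.
apply: ler_wsqrtr.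
rewrite -(real_normK (num_real x)) -(real_normK (num_real y)).
by have := normr_ge0 x; have := normr_ge0 y; nra.
Qed.

Lemma re_eq1 z : `|z| <= 1 -> re z = 1 -> z = 1.
Proof.
case: k z => //= -[x y] /[swap] /= ->; rewrite normc_def /= (lecR _ 1) => le1.
suff -> : y = 0 by [].
apply/eqP; rewrite -sqrf_eq0 eq_le sqr_ge0 andbT.
have := le1; rewrite -[X in _ <= X]sqrtr1 ler_sqrt//.
by rewrite expr1n; lra.
Qed.

End Scalars.

(** * Passing from real functionals to linear functionals over the scalars *)

Section Realification.
Context {R : realType} {k : scalar_kind}.
Local Notation K := (scalars R k).
Local Notation ofR := (of_real k).
Local Notation re := (@real_part _ k).
Local Notation i := (imaginary_unit k).
Variable X : normedModType K.

(** Restriction of scalars to the reals. *)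
Definition realify : Type := X.
HB.instance Definition _ := GRing.Zmodule.on realify.

Definition real_scale (a : R) (x : realify) : realify := ofR a *: (x : X).

Lemma real_scaleA a b x : real_scale a (real_scale b x) = real_scale (a * b) x.
Proof. by rewrite /real_scale scalerA of_realM. Qed.

Lemma real_scale1 : left_id 1 real_scale.
Proof. by move=> x; rewrite /real_scale of_real1 scale1r. Qed.

Lemma real_scaleDr : right_distributive real_scale +%R.
Proof. by move=> a x y; rewrite /real_scale scalerDr. Qed.

Lemma real_scaleDl x : {morph real_scale^~ x : a b / a + b}.
Proof. by move=> a b; rewrite /real_scale of_realD scalerDl. Qed.

HB.instance Definition _ := GRing.Zmodule_isLmodule.Build R realify
  real_scaleA real_scale1 real_scaleDr real_scaleDl.

Definition real_norm (x : realify) : R := re `|x : X|.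

Lemma real_normE (x : X) : `|x| = ofR (real_norm x).
Proof. exact: ge0_of_real. Qed.

Lemma real_norm_ge0 x : 0 <= real_norm x.
Proof.
by rewrite -(ler_of_real (k := k)) -real_normE of_real0.
Qed.

Lemma real_normD (x y : realify) :
  real_norm (x + y) <= real_norm x + real_norm y.
Proof. by rewrite -(ler_of_real (k := k)) of_realD -!real_normE ler_normD. Qed.

Lemma real_normZ a (x : realify) : real_norm (a *: x) = `|a| * real_norm x.
Proof.
rewrite /real_norm [a *: x]/(ofR a *: (x : X)) normrZ norm_of_real.
by rewrite real_normE reZ !reK.
Qed.

Lemma real_norm_eq0 (x : realify) : real_norm x = 0 -> x = 0.
Proof.
move=> x0; apply/(@normr0_eq0 _ X).
by rewrite real_normE x0 of_real0.
Qed.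

Lemma real_norm_le1 (x : X) : (`|x| <= 1) = (real_norm x <= 1).
Proof. by rewrite real_normE -(of_real1 (k := k)) ler_of_real. Qed.

End Realification.

(** Over the complex numbers, [f x = phi x - i * phi (i x)]. *)
Lemma complexify_function (R : realType) (k : scalar_kind)
    (X : normedModType (scalars R k)) (phi : realify X -> R) :
  (forall x y, phi (x + y) = phi x + phi y) ->
  (forall a x, phi (a *: x) = a * phi x) ->
  exists f : X -> scalars R k, (forall a x y, f (a *: x + y) = a * f x + f y) /\
    forall x, real_part (f x) = phi x.
Proof.
case: k X phi => X phi phiD phiZ.
  by exists phi; split=> // a x y; rewrite phiD; congr (_ + _); exact: phiZ.
pose iX (x : X) : X := ('i)%C *: x.
exists (fun x => Complex (phi x) (- phi (iX x))); split=> // -[a b] x y.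
have scaleE (z : X) : Complex a b *: z = ((a%:C)%C *: z + (b%:C)%C *: iX z : X).
  rewrite /iX scalerA -scalerDl; congr (_ *: _).
  by apply/eqP; rewrite eq_complex /=; apply/andP; split; apply/eqP; ring.
have phiC (c : R) (z : X) : phi ((c%:C)%C *: z) = c * phi z by exact: phiZ.
have phiN (z : X) : phi (- z) = - phi z.
  by have := phiC (-1) z; rewrite (rmorphN1 (real_complex R)) scaleN1r mulN1r.
have ii (z : X) : iX (iX z) = - z.
  rewrite /iX scalerA -scaleN1r; congr (_ *: _).
  by apply/eqP; rewrite eq_complex /=; apply/andP; split; apply/eqP; ring.
have iXE z : iX (Complex a b *: z) = Complex a b *: iX z.
  by rewrite /iX !scalerA mulrC.
have phiS z : phi (Complex a b *: z) = a * phi z + b * phi (iX z).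
  by rewrite scaleE phiD !phiC.
rewrite phiD phiS /iX scalerDr phiD -/(iX _) -/(iX _) iXE phiS ii phiN.
by apply/eqP; rewrite eq_complex /=; apply/andP; split; apply/eqP; ring.
Qed.

Section Complexification.
Context {R : realType} {k : scalar_kind}.
Local Notation K := (scalars R k).
Local Notation ofR := (of_real k).

Lemma linear_of_function (U V : lmodType K) (f : U -> V) :
  (forall a x y, f (a *: x + y) = a *: f x + f y) ->
  exists F : {linear U -> V}, forall x, F x = f x.
Proof.
move=> fL; pose mx := GRing.isLinear.Build K U V *:%R f fL.
pose F : {linear U -> V} := HB.pack f mx.
by exists F.
Qed.

(** Rotating [x] makes [f x] a nonnegative real, so the bound on the real part
    of [f] bounds [f]. *)
Lemma complexify (X : normedModType K) (phi : realify X -> R) :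
  contraction (@real_norm _ _ X) phi ->
  exists f : {linear X -> K^o}, (forall x, `|f x| <= `|x|) /\
    forall x, real_part (f x) = phi x.
Proof.
move=> [[phiD phiZ _] phiN]; have [f [fL fre]] := complexify_function phiD phiZ.
have [F FE] := @linear_of_function X K^o f fL.
exists F; split=> x; last by rewrite FE fre.
have [->|Fx] := eqVneq (F x) 0; first by rewrite normr0.
pose u := `|F x| / F x.
have nu : `|u| = 1 by rewrite normrM normfV normr_id divff// normr_eq0.
have Fux : F (u *: x) = `|F x| by rewrite linearZ/= /u [_ *: _]divfK.
rewrite (ge0_of_real (normr_ge0 (F x))) -Fux FE fre.
apply: (@le_trans _ _ (ofR (real_norm (u *: x)))).
  by rewrite ler_of_real (le_trans (ler_norm _))// phiN.
by rewrite -real_normE normrZ nu mul1r.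
Qed.

End Complexification.

(** * An operator into bounded sequences that does not attain its norm *)

Section NonAttaining.
Context {R : realType} {k : scalar_kind}.
Local Notation K := (scalars R k).
Local Notation ofR := (of_real k).
Variable X : normedModType K.
Hypothesis Xinf : ~ finite_dimensional X.

(** Eventually the real parts of [f n x] and of [i * f n x] are both at most 1/2
    in absolute value, so that the modulus of [f n x] is at most 3/4. *)
Lemma slack_functionals : exists f : nat -> {linear X -> K^o},
  [/\ forall n x, `|f n x| <= `|x|,
      forall n, exists x, `|x| <= 1 /\ ofR (1 - n.+1%:R^-1) <= `|f n x|
    & forall x, `|x| <= 1 -> exists m, forall n, (m <= n)%N ->
        `|f n x| <= ofR (3 / 4)].
Proof.
have [|phi [Cphi phi1 phis]] := @slack_sequence_infinite_dimensional
    R (realify X) (@real_norm _ _ X) (@real_norm_ge0 _ _ X) (@real_normD _ _ X)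
    (@real_normZ _ _ X) (@real_norm_eq0 _ _ X).
  move=> n v; apply: contrapT => nx; apply: Xinf; exists n, (fun i => v i) => x.
  apply: contrapT => xv; apply: nx; exists x => c xE; apply: xv.
  by exists (fun i => ofR (c i)); rewrite xE.
have /choice[f fP] : forall n, exists f : {linear X -> K^o},
    (forall x, `|f x| <= `|x|) /\ forall x, real_part (f x) = phi n x.
  by move=> n; exact: complexify.
exists f; split=> [n x|n|x x1]; first by have [] := fP n.
  have [x [x1 xn]] := phi1 n; exists x; rewrite real_norm_le1; split=> //.
  apply: le_trans (re_le_norm _); rewrite ler_of_real.
  by have [_ ->] := fP n.
have [m mP] : exists m, forall n, (m <= n)%N -> `|phi n x| <= 2^-1.
  by apply: phis; rewrite -real_norm_le1.
pose ix := imaginary_unit k *: x.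
have [p pP] : exists m, forall n, (m <= n)%N -> `|phi n ix| <= 2^-1.
  apply: phis; rewrite -real_norm_le1 normrZ.
  by apply: mulr_ile1 => //; exact: norm_imaginary_unit.
exists (maxn m p) => n; rewrite geq_max => /andP[mn pn].
have [_ fre] := fP n; apply: re_i_norm_le; first by rewrite fre mP.
have -> : imaginary_unit k * f n x = f n ix by rewrite /ix linearZ.
by rewrite fre pP.
Qed.

(** The operator [y |-> (g n y)] has norm 1, as witnessed by [x], but shrinks
    every unit vector.  The weights [1 - 1 / (n + 2)] take care of the finitely
    many indices at which the bound 3/4 may fail. *)
Lemma nonattaining_functionals :
  exists (g : nat -> {linear X -> K^o}) (x : nat -> X) (c : nat -> R),
  [/\ forall n y, `|g n y| <= `|y|,
      forall n, `|x n| = 1,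
      forall n, g n (x n) = ofR (c n),
      forall n, (1 - n.+2%:R^-1) ^+ 2 <= c n <= 1
    & forall y, `|y| = 1 -> exists2 rho, rho < 1 &
        forall n, `|g n y| <= ofR rho].
Proof.
have [f [fN f1 fs]] := slack_functionals.
(* Shifting [f] by one makes the lower bound for its norm equal to the weight,
   hence positive: [f 0] may vanish. *)
pose r n : R := 1 - n.+2%:R^-1.
have inv2 n : 0 < n.+2%:R^-1 :> R by rewrite invr_gt0.
have inv2' n : n.+2%:R^-1 < 1 :> R by rewrite invf_lt1// ltr1n.
have r01 n : 0 < r n < 1.
  by rewrite /r subr_gt0 inv2' ltrBlDr ltrDl inv2.
have r0 n : 0 <= r n by have /andP[/ltW] := r01 n.
have ofr0 n : 0 <= ofR (r n) by rewrite -(of_real0 (k := k)) ler_of_real.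
have ofr1 n : ofR (r n) <= 1.
  by rewrite -(of_real1 (k := k)) ler_of_real ltW//; have /andP[] := r01 n.
have /choice[g gE] : forall n, exists g : {linear X -> K^o},
    forall y, g y = ofR (r n) * f n.+1 y.
  move=> n; apply: linear_of_function => a x y.
  by rewrite linearP/= mulrDr -[_ *: (_ : K^o)]/(_ * _) mulrCA.
have g_norm n y : `|g n y| = ofR (r n) * `|f n.+1 y|.
  by rewrite gE normrM norm_of_real (ger0_norm (r0 n)).
have g_le n y : `|g n y| <= `|y|.
  rewrite g_norm (le_trans _ (fN n.+1 y))// ler_piMl//.
have /choice[x xP] : forall n, exists x, `|x| = 1 /\
    exists b : R, f n.+1 x = ofR b /\ r n <= b <= 1.
  move=> n; have [y [y1 yn]] := f1 n.+1.
  pose z := f n.+1 y; have z0 : 0 < `|z|.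
    apply: lt_le_trans yn; rewrite -(of_real0 (k := k)) lt_def ler_of_real.
    have /andP[rn0 _] := r01 n; rewrite (ltW rn0) andbT.
    apply: contraTneq rn0 => /(congr1 (@real_part _ k)); rewrite !reK => rE.
    by rewrite /r rE ltxx.
  have ny : 0 < `|y| by exact: lt_le_trans (fN n.+1 y).
  pose a := `|z| / z / `|y|.
  have na : `|a| = `|y|^-1.
    rewrite /a !normrM !normfV !normr_id divff ?mul1r//.
    by rewrite gt_eqF.
  have fa : f n.+1 (a *: y) = `|z| / `|y|.
    rewrite linearZ/= /a -[_ *: (_ : K^o)]/(_ * _) -/z mulrAC divfK//.
    by rewrite -normr_gt0.
  exists (a *: y); rewrite normrZ na mulVf ?gt_eqF//; split=> //.
  exists (real_part (`|z| / `|y|)).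
  have zy : `|z| / `|y| = ofR (real_part (`|z| / `|y|)).
    by apply: ge0_of_real; rewrite divr_ge0.
  split; first by rewrite fa -zy.
  rewrite -!(ler_of_real (k := k)) -zy of_real1 ler_pdivrMr// mul1r fN andbT.
  by rewrite ler_pdivlMr// (le_trans _ yn)// ler_piMr.
have /choice[b bP] : forall n, exists b : R,
    f n.+1 (x n) = ofR b /\ r n <= b <= 1.
  by move=> n; have [] := xP n.
exists g, x, (fun n => r n * b n); split=> //.
- by move=> n; have [] := xP n.
- by move=> n; rewrite gE; have [-> _] := bP n; rewrite of_realM.
- move=> n; have [_ /andP[rb b1]] := bP n; have /andP[rn0 rn1] := r01 n.
  by rewrite -/(r n); apply/andP; split; nra.
- move=> y y1; have [m mP] := fs y ltac:(by rewrite y1).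
  have [rho [rho34 rho1 rhoP]] : exists rho, [/\ 3 / 4 <= rho, rho < 1 &
      forall n, (n < m)%N -> `|g n y| <= ofR rho].
    elim: (m) => [|p [rho [rho34 rho1 rhoP]]].
      by exists (3 / 4); split=> //; lra.
    exists (Num.max rho (r p)); split.
    - by rewrite le_max rho34.
    - by rewrite gt_max rho1; have /andP[] := r01 p.
    - move=> n; rewrite ltnS leq_eqVlt => /predU1P[->|np].
        rewrite g_norm (@le_trans _ _ (ofR (r p)))//; last first.
          by rewrite ler_of_real le_max lexx orbT.
        by rewrite ler_piMr// (le_trans (fN _ _))// y1.
      by rewrite (le_trans (rhoP n np))// ler_of_real le_max lexx.
  exists rho => // n; have [mn|nm] := leqP m n; last exact: rhoP.
  rewrite g_norm (@le_trans _ _ (ofR (3 / 4)))//; last by rewrite ler_of_real.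
  apply: (le_trans _ (mP n.+1 (leqW mn))); rewrite ler_piMl//.
Qed.

End NonAttaining.

(** * Completeness of the space of bounded functions *)

Section BfunComplete.
Context {R : realType} {k : scalar_kind}.
Local Notation K := (scalars R k).
Variables (T : Type) (V : completeNormedModType K).
Local Notation B := (@bfun R k T V).

Lemma bfun_norm_ge (f : B) x : `|f x| <= `|f|.
Proof. exact: sup_norm_ge. Qed.

Lemma bfun_norm_le (f : B) M : 0 <= M -> (forall x, `|f x| <= M) -> `|f| <= M.
Proof. exact: sup_norm_le. Qed.

Lemma bfun_ball (f h : B) e : ball f e h -> `|f - h| < e.
Proof. by rewrite -[ball f e]/(ball_ _ f e). Qed.

Lemma bfun_complete (F : set_system B) : ProperFilter F -> cauchy F -> cvg F.
Proof.
move=> PF cF; have cE e : 0 < e -> exists f : B, F (ball f e).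
  by move=> e0; move/cauchyP : cF => /(_ e e0)[f fe]; exists f.
have cx x : (fun f : B => f x) @ F --> lim ((fun f : B => f x) @ F).
  apply/cauchy_cvgP/cauchyP => e e0.
  have [f fe] := cE e e0; exists (f x).
  suff : F [set h : B | ball (f x) e (h x)] by [].
  apply: (filterS _ fe) => h /bfun_ball fh.
  rewrite /= -ball_normE /=; apply: le_lt_trans fh.
  exact: (bfun_norm_ge (f - h)).
pose l x := lim ((fun f : B => f x) @ F).
have lE e f : 0 < e -> F (ball f e) -> forall x, `|l x - f x| <= e.
  move=> e0 fe x; apply/ler_addgt0Pr => d d0.
  have /filter_ex[h [he hd]] : F (ball f e `&` [set h : B | `|l x - h x| < d]).
    apply: filterI => //.
    by have /cvgrPdist_lt /(_ d d0) := cx x.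
  rewrite -(subrKA (h x)) [leRHS]addrC (le_trans (ler_normD _ _))// lerD//.
    exact: ltW.
  move/bfun_ball : he; rewrite distrC => /ltW; apply: le_trans.
  exact: (bfun_norm_ge (h - f)).
have [f1 f1F] := cE 1 ltr01.
have lb : l \in bounded_fun_pred (T := T) (V := V).
  apply/bounded_fun_predP; exists (1 + `|f1|) => x.
  rewrite -(subrK (f1 x) (l x)) (le_trans (ler_normD _ _))// lerD ?lE//.
  exact: bfun_norm_ge.
apply/cvg_ex; exists (BFun lb); apply/cvgrPdist_le => e e0.
have e2 : 0 < e / 2 by rewrite divr_gt0.
have [f fe] := cE _ e2; apply: (filterS _ fe) => h /bfun_ball/ltW fh.
apply: bfun_norm_le; first exact: ltW.
move=> x.
rewrite (_ : (BFun lb - h : B) x = (l x - f x) + (f x - h x)); last first.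
  by rewrite subrKA.
rewrite (le_trans (ler_normD _ _))//.
rewrite [leRHS]splitr lerD ?lE//; apply: le_trans fh.
exact: (bfun_norm_ge (f - h)).
Qed.

HB.instance Definition _ := Uniform_isComplete.Build B bfun_complete.

End BfunComplete.

(** * Functionals of norm one and numerical ranges *)

Section DualSphere.
Context {R : realType} {k : scalar_kind}.
Local Notation K := (scalars R k).
Variable V : normedModType K.
Implicit Types (phi : {linear V -> K^o}) (v : V).

Let values phi : set K := [set `|phi v| | v in [set v : V | `|v| <= 1]].

Lemma opnorm_supremums phi : bounded_operator phi ->
  supremums (values phi) (opnorm phi).
Proof.
move=> [M phiM]; apply: (@scalars_supremum R k (values phi)).
- by exists `|phi 0|, 0 => //=; rewrite normr0.
- by move=> _ [v _ <-].
exists `|M| => _ [v /= v1 <-]; apply: (le_trans (phiM v)).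
have : 0 <= M * `|v| by exact: le_trans (phiM v).
by move=> /ger0_norm <-; rewrite normrM normr_id ler_piMr.
Qed.

Lemma dual_unit_sphere_le phi v : dual_unit_sphere phi -> `|phi v| <= `|v|.
Proof.
move=> [bphi phi1]; have [ub _] := opnorm_supremums bphi; rewrite phi1 in ub.
have [->|v0] := eqVneq v 0; first by rewrite linear0 normr0.
have nv : 0 < `|v| by rewrite normr_gt0.
have : `|phi (`|v|^-1 *: v)| <= 1.
  apply: ub; exists (`|v|^-1 *: v) => //=.
  by rewrite normrZ normfV normr_id mulVf ?gt_eqF.
rewrite linearZ/= -[_ *: (_ : K^o)]/(_ * _) normrM normfV normr_id mulrC.
by rewrite ler_pdivrMr// mul1r.
Qed.

Lemma norming_functionalsI phi v : (forall w, `|phi w| <= `|w|) -> `|v| <= 1 ->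
  phi v = 1 -> norming_functionals v phi.
Proof.
move=> phiN v1 phiv.
have bphi : bounded_operator phi by exists 1 => w; rewrite mul1r.
have [ub lb] := opnorm_supremums bphi; split=> //; split=> //.
apply/eqP; rewrite eq_le; apply/andP; split.
  by apply: lb => _ [w /= w1 <-]; exact: le_trans (phiN w) w1.
by apply: ub; exists v => //; rewrite phiv normr1.
Qed.

End DualSphere.

Lemma closed_convex_hull_sub0 (R : realType) (k : scalar_kind)
    (V : normedModType (scalars R k)) (A : set V) :
  A `<=` [set 0] -> closed_convex_hull A `<=` [set 0].
Proof.
apply: smallest_sub; split.
  exact/accessible_closed_set1/hausdorff_accessible/norm_hausdorff.
move=> x y t; rewrite !inE /= => -> ->.
by rewrite convmm.
Qed.

(** * The superspace and the two ranges *)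

(** The superspace consists of the bounded sequences in [X]; coordinate 0
    carries [X] itself, and the other coordinates carry the scalars [g n y] as
    multiples of a unit vector [u]. *)
Section Superspace.
Context {R : realType} {k : scalar_kind}.
Local Notation K := (scalars R k).
Local Notation ofR := (of_real k).
Variables (X : completeNormedModType K) (u : X) (g : nat -> {linear X -> K^o}).
Hypothesis u1 : `|u| = 1.
Hypothesis gN : forall n y, `|g n y| <= `|y|.
Local Notation Y := (@bfun R k nat X).

(** The embedding is the case [s = 1] and the operator is the case [s = 0]. *)
Lemma shifted_coordinates (s : K) : exists F : {linear X -> Y},
  forall y n, F y n = if n is m.+1 then g m y *: u else s *: y.
Proof.
pose c y n := if n is m.+1 then g m y *: u else s *: y.
have cB y : c y \in bounded_fun_pred (T := nat) (V := X).
  apply/bounded_fun_predP; exists (`|s * `|y| | + `|y|) => -[|m]; rewrite /c.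
    by rewrite normrM normr_id normrZ lerDl.
  by rewrite normrZ u1 mulr1 (le_trans (gN m y))// lerDr.
have [|F FE] := @linear_of_function R k X Y (fun y => BFun (cB y)).
  move=> a x y; apply/val_inj/funext => n.
  rewrite [RHS]/(a *: c x n + c y n) /= /c; case: n => [|m].
    by rewrite scalerDr !scalerA mulrC.
  by rewrite linearP/= scalerDl scalerA.
by exists F => y n; rewrite FE.
Qed.

Variables J T : {linear X -> Y}.
Hypothesis JE : forall y n, J y n = if n is m.+1 then g m y *: u else y.
Hypothesis TE : forall y n, T y n = if n is m.+1 then g m y *: u else 0.

Lemma embedding_isometry : linear_isometry J.
Proof.
move=> y; apply/eqP; rewrite eq_le; apply/andP; split.
  by apply: bfun_norm_le => // -[|m]; rewrite JE// normrZ u1 mulr1.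
by have := bfun_norm_ge (J y) 0; rewrite JE.
Qed.

Lemma operator_norm_le y : `|T y| <= `|y|.
Proof.
by apply: bfun_norm_le => // -[|m]; rewrite TE ?normr0// normrZ u1 mulr1.
Qed.

(** As [sup |g n y| <= rho < 1], the vector [J y + a *: T y] has norm at most 1
    whenever [(1 + |a|) * rho <= 1].  Hence [|1 + a * psi (T y)| <= 1] for all
    small scalars [a], which is impossible for a suitable argument of [a] unless
    [psi (T y)] vanishes. *)
Lemma spatial_value_eq0 y (psi : {linear Y -> K^o}) (rho : R) : `|y| = 1 ->
  rho < 1 -> (forall n, `|g n y| <= ofR rho) ->
  norming_functionals (J y) psi -> psi (T y) = 0.
Proof.
move=> y1 rho1 grho [psiS psiJ]; apply/eqP/negPn/negP => w0.
have d0 : 0 < (1 - rho) / 2 by lra.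
set d := (1 - rho) / 2 in d0; set w := psi (T y) in w0.
have od0 : 0 < ofR d.
  by rewrite lt_def -(of_real0 (k := k)) ler_of_real (ltW d0) andbT;
    apply/eqP => /(congr1 (@real_part _ k)); rewrite !reK; lra.
have rho0 : 0 <= rho.
  by rewrite -(ler_of_real (k := k)) of_real0 (le_trans _ (grho 0%N)).
pose a := ofR d * (`|w| / w).
have na : `|a| = ofR d.
  rewrite normrM (gtr0_norm od0) normrM normfV normr_id divff ?mulr1//.
  by rewrite normr_eq0.
have : `|psi (J y + a *: T y)| <= 1.
  apply: (le_trans (dual_unit_sphere_le _ psiS)).
  apply: bfun_norm_le => // n.
  have -> : (J y + a *: T y) n = J y n + a *: T y n by [].
  rewrite JE TE; case: n => [|m]; first by rewrite scaler0 addr0 y1.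
  rewrite scalerA -scalerDl normrZ u1 mulr1.
  rewrite -[X in X + _]mul1r -mulrDl normrM.
  apply: (@le_trans _ _ (ofR (1 + d) * ofR rho)).
    apply: ler_pM => //; rewrite of_realD of_real1 (le_trans (ler_normD _ _))//.
    by rewrite normr1 na.
  by rewrite -of_realM -(of_real1 (k := k)) ler_of_real /d; nra.
rewrite linearD linearZ/= psiJ -[_ *: (_ : K^o)]/(a * w) /a -mulrA divfK//.
have dw : 0 < ofR d * `|w| by rewrite mulr_gt0 ?normr_gt0.
have w1 : 0 <= 1 + ofR d * `|w| by rewrite addr_ge0// ltW.
by rewrite (ger0_norm w1) -[leRHS]addr0 lerD2l lt_geF.
Qed.

Variables (x : nat -> X) (c : nat -> R).
Hypothesis x1 : forall n, `|x n| = 1.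
Hypothesis gx : forall n, g n (x n) = ofR (c n).
Hypothesis c1 : forall n, (1 - n.+2%:R^-1) ^+ 2 <= c n <= 1.

(** On bounded functions [h] consider the generalized limit of the coordinate
    [n + 1] of [h (x n)], measured by a functional norming [u].  Both [J] and
    [T] have the coordinate [g n (x n)] there, which tends to 1. *)
Lemma intrinsic_value1 (isoJ : linear_isometry J) (bT : bounded_operator T) :
  intrinsic_range isoJ (restrict_sphere bT) 1.
Proof.
have xS n : x n \in unit_sphere X by rewrite inE /unit_sphere /= x1.
pose xs n : unit_sphere X := exist _ (x n) (xS n).
have [L HL] := @generalized_limit_exists R.
have [psi [[[psiD psiZ _] psiN] psiu]] := @norming_functional R (realify X)
  (@real_norm _ _ X) (@real_normD _ _ X) (@real_normZ _ _ X) u.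
have {}psiu : psi u = 1 by rewrite psiu /real_norm u1 -(of_real1 (k := k)) reK.
pose E := @bfun R k (unit_sphere X) Y.
pose a (h : E) n := psi (h (xs n) n.+1).
have aN h n : `|a h n| <= real_norm h.
  apply: (le_trans (psiN _)); rewrite -(ler_of_real (k := k)) -!real_normE.
  apply: (le_trans (bfun_norm_ge _ _)); exact: sup_norm_ge.
have ba h : bounded_seq (a h) by exists (real_norm h).
pose phi (h : realify E) : R := L (a h).
have Cphi : contraction (@real_norm _ _ E) phi.
  have phiN h : `|phi h| <= real_norm h by exact: (glim_norm_le HL).
  split=> //; split; last by exists 1 => h; rewrite mul1r.
    move=> h h'; rewrite /phi -(glim_add HL)//; congr L; apply/funext => n.
    have aD : (h + h') (xs n) n.+1 = h (xs n) n.+1 + h' (xs n) n.+1 by [].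
    by rewrite /a aD psiD.
  move=> b h; rewrite /phi -(glim_scale HL)//; congr L; apply/funext => n.
  have aZ : (b *: h) (xs n) n.+1 = b *: (h (xs n) n.+1 : realify X) by [].
  by rewrite /a aZ psiZ.
have [Phi [PhiN PhiE]] := complexify Cphi.
have Lc : L c = 1.
  have bc : bounded_seq c.
    exists 1 => n; have /andP[c0 cn1] := c1 n.
    by rewrite ger0_norm// (le_trans _ c0)// sqr_ge0.
  apply/eqP; rewrite eq_le; apply/andP; split.
    by apply: (glim_le HL) => //; exists 0%N => n _; have /andP[] := c1 n.
  apply/ler_addgt0Pr => e e0; rewrite -lerBlDr; apply: (glim_ge HL) => //.
  have sq_ge (t : R) : t <= e / 2 -> 1 - e <= (1 - t) ^+ 2.
    by have := sqr_ge0 t; rewrite sqrrB expr1n; lra.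
  exists (Num.bound (2 / e)) => n en; have /andP[cn _] := c1 n.
  apply: le_trans cn; have n0 : 0 < n.+2%:R :> R by rewrite ltr0n.
  have en2 : n.+2%:R^-1 <= e / 2.
    rewrite -[leRHS]invrK lef_pV2 ?posrE ?invr_gt0 ?divr_gt0// invf_div.
    apply: ltW; apply: (lt_le_trans (archi_boundP _)).
      by rewrite divr_ge0// ltW.
    by rewrite ler_nat (leq_trans en)// -addn2 leq_addr.
  exact: sq_ge.
have value (F : {linear X -> Y}) (bF : bounded_operator F) :
    (forall y, `|F y| <= `|y|) -> (forall y n, F y n.+1 = g n y *: u) ->
    Phi (restrict_sphere bF) = 1.
  move=> FN FE; apply: re_eq1.
    apply: (le_trans (PhiN _)); apply: bfun_norm_le => // -[y yS] /=.
    by move: (yS) (FN y); rewrite inE /unit_sphere /= => ->.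
  rewrite PhiE /phi -Lc; congr L; apply/funext => n.
  by rewrite /a /= FE gx [psi _]psiZ psiu mulr1.
exists Phi; last by apply: value => *; rewrite ?operator_norm_le// TE.
apply: norming_functionalsI => //.
  apply: bfun_norm_le => // -[y yS] /=.
  by move: yS; rewrite inE /unit_sphere /= isoJ => ->.
by apply: value => *; rewrite ?isoJ// JE.
Qed.

End Superspace.

Theorem theorem2p1 (R : realType) (k : scalar_kind)
    (X : completeNormedModType (scalars R k)) :
  ~ finite_dimensional X ->
  exists (Y : completeNormedModType (scalars R k)) (J : {linear X -> Y})
      (isoJ : linear_isometry J) (T : {linear X -> Y}) (bT : bounded_operator T),
    closed_convex_hull (spatial_range J (restrict_sphere bT)) <>
      intrinsic_range isoJ (restrict_sphere bT).
Proof.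
move=> /nonattaining_functionals[g [x [c [gN x1 gx c1 grho]]]].
have u1 : `|x 0%N| = 1 by exact: x1.
have [J JE1] := shifted_coordinates u1 gN 1.
have [T TE0] := shifted_coordinates u1 gN 0.
have JE y n : J y n = if n is m.+1 then g m y *: x 0%N else y.
  by rewrite JE1; case: n => //; rewrite scale1r.
have TE y n : T y n = if n is m.+1 then g m y *: x 0%N else 0.
  by rewrite TE0; case: n => //; rewrite scale0r.
have isoJ := embedding_isometry u1 gN JE.
have bT : bounded_operator T.
  by exists 1 => y; rewrite mul1r; exact: (operator_norm_le u1 gN TE).
exists (@bfun R k nat X : completeNormedModType (scalars R k)).
exists J, isoJ, T, bT => WV.
have := intrinsic_value1 u1 gN JE TE x1 gx c1 isoJ bT; rewrite -WV.
move=> /closed_convex_hull_sub0 /= H; have := oner_neq0 (scalars R k).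
rewrite H ?eqxx// => _ [[[y yS] psi] /= psiJ <-] /=.
have y1 : `|y| = 1 := set_mem yS; have [rho rho1 rhoP] := grho y y1.
exact: (spatial_value_eq0 u1 JE TE y1 rho1 rhoP psiJ).
Qed.
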